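(* Let $c_1,\dots,c_s$ be distinct real parameters, let $T>0$, let $\{u_k\}_{k=1}^s$ be a set of sufficiently smooth, linearly independent basis functions satisfying the collocation condition for FRKN methods, and consider the problem $y''(t)=f(t,y(t))$ with $f:\mathbb{R}\times\mathbb{R}\to\mathbb{R}$ sufficiently smooth and Lipschitz continuous in $y$. Let $q\geq1$ be an integer. Then the $s$-stage FRKN method with respect to $\{u_k\}_{k=1}^s$ is of order $s+q$ if the collocation parameters $(c_i)_{i=1}^s$ satisfy $$\int_0^1\xi^j\prod_{i=1}^s(\xi-c_i)\,d\xi=0,\qquad j=0,\dots,q-1.$$
   Context: Notation: $\boldsymbol{c}=(c_1,\dots,c_s)^T$, $\boldsymbol{e}=(1,\dots,1)^T\in\mathbb{R}^s$; scalar functions are applied componentwise to vectors, and $f(\boldsymbol{e}t+\boldsymbol{c}h,\boldsymbol{Y})=(f(t+c_1h,Y_1),\dots,f(t+c_sh,Y_s))^T$. The integration interval is $[t_0,t_0+T]$. The basis $\{u_k\}$ does not include $1$ or $t$. FRKN method: the coefficients $\boldsymbol{A}(t,h)\in\mathbb{R}^{s\times s}$, $\boldsymbol{b}(t,h),\boldsymbol{d}(t,h)\in\mathbb{R}^s$ are determined by the relations, for all $k=1,\dots,s$, $$u_k(t+h)=u_k(t)+hu_k'(t)+h^2\boldsymbol{b}(t,h)^Tu_k''(\boldsymbol{e}t+\boldsymbol{c}h),$$ $$u_k'(t+h)=u_k'(t)+h\,\boldsymbol{d}(t,h)^Tu_k''(\boldsymbol{e}t+\boldsymbol{c}h),$$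 $$u_k(\boldsymbol{e}t+\boldsymbol{c}h)=\boldsymbol{e}u_k(t)+h\boldsymbol{c}u_k'(t)+h^2\boldsymbol{A}(t,h)u_k''(\boldsymbol{e}t+\boldsymbol{c}h).$$ One step of size $h$ from $(t_n,y_n,y_n')$ is, with $t_{n+1}=t_n+h$ and coefficients evaluated at $(t_n,h)$, $$\boldsymbol{Y}_n=\boldsymbol{e}y_n+\boldsymbol{c}hy_n'+h^2\boldsymbol{A}f(\boldsymbol{e}t_n+\boldsymbol{c}h,\boldsymbol{Y}_n),$$ $$y_{n+1}=y_n+hy_n'+h^2\boldsymbol{b}^Tf(\boldsymbol{e}t_n+\boldsymbol{c}h,\boldsymbol{Y}_n),\qquad y_{n+1}'=y_n'+h\,\boldsymbol{d}^Tf(\boldsymbol{e}t_n+\boldsymbol{c}h,\boldsymbol{Y}_n).$$ Collocation condition for FRKN methods: for any given $t$, the $s\times s$ matrices $\boldsymbol{E}(t,h)$, with $(i,k)$ entry $u_k(t+c_ih)-u_k(t)-c_ihu_k'(t)$, and $\boldsymbol{F}(t,h)$, with $(i,k)$ entry $u_k''(t+c_ih)$, are both nonsingular for almost every $h\in[0,T]$. Order: let $y(t)$ be the exact solution of $y''=f(t,y)$ with $y(t_n)=y_n$, $y'(t_n)=y_n'$, and suppose that (as $h\to0$) $y(t_{n+1})-y_{n+1}=O(h^{p_1+1})$ and $y'(t_{n+1})-y_{n+1}'=O(h^{p_2+1})$. Then the (global) order of accuracy is $p=\min\{p_1,p_2\}$. These are upper-bound estimates: the statement that the method is of order $p$ means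 that such estimates hold.
   Formalization: The formal theorem adds that the Wronskian of u_1'',...,u_s'' is nonzero at the step point t_n; without it the claim fails, e.g. s=q=1, c_1=1/2, u_1=t^3, t_n=0, f=1 gives error h^2/6 in y. *)

(* Defs.v *)
From HB Require Import structures.
From mathcomp Require Import all_boot all_order all_algebra.
From mathcomp Require Import all_classical all_reals all_analysis.
Import Order.TTheory GRing.Theory Num.Theory numFieldNormedType.Exports.

Set Implicit Arguments.
Unset Strict Implicit.
Unset Printing Implicit Defensive.

Local Open Scope classical_set_scope.
Local Open Scope ring_scope.

Local Notation "f ^` ()" := (derive1 f) : ring_scope.
Local Notation "f ^` ( n )" := (derive1n n f) : ring_scope.

(* Class C^n through directional derivatives; on a finite-dimensional V (here
   R and R * R) this is the usual class C^n. *)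
Fixpoint class_C (R : realType) (V : normedModType R) (n : nat) (f : V -> R)
    {struct n} : Prop :=
  continuous f /\
  match n with
  | 0 => True
  | m.+1 => forall v : V,
      (forall x : V, derivable f x v) /\ class_C m (fun x : V => 'D_v f x)
  end.

Definition lipschitz_snd (R : realType) (f : R * R -> R) : Prop :=
  exists L : R, forall t y z : R, `|f (t, y) - f (t, z)| <= L * `|y - z|.

Definition lin_indep (R : realType) (s : nat) (u : 'I_s -> R -> R) : Prop :=
  forall a : 'I_s -> R,
    (forall t : R, \sum_(k < s) a k * u k t = 0) -> forall k, a k = 0.

Definition collocE (R : realType) (s : nat) (c : 'I_s -> R)
    (u : 'I_s -> R -> R) (t h : R) : 'M[R]_s :=
  \matrix_(i, k) (u k (t + c i * h) - u k t - c i * h * (u k)^`() t).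

Definition collocF (R : realType) (s : nat) (c : 'I_s -> R)
    (u : 'I_s -> R -> R) (t h : R) : 'M[R]_s :=
  \matrix_(i, k) (u k)^`(2) (t + c i * h).

Definition collocation_condition (R : realType) (s : nat) (t0 T : R)
    (c : 'I_s -> R) (u : 'I_s -> R -> R) : Prop :=
  forall t : R, t0 <= t <= t0 + T ->
    {ae @lebesgue_measure R, forall h : R, 0 <= h <= T ->
       collocE c u t h \in unitmx /\ collocF c u t h \in unitmx}.

(* A, b, d are values at (t, h) of the coefficients of the FRKN method. *)
Definition frkn_coeffs (R : realType) (s : nat) (c : 'I_s -> R)
    (u : 'I_s -> R -> R) (t h : R)
    (A : 'M[R]_s) (b d : 'I_s -> R) : Prop :=
  forall k : 'I_s,
    [/\ u k (t + h) = u k t + h * (u k)^`() t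
          + h ^+ 2 * \sum_(i < s) b i * (u k)^`(2) (t + c i * h),
        (u k)^`() (t + h) = (u k)^`() t
          + h * \sum_(i < s) d i * (u k)^`(2) (t + c i * h)
      & forall i : 'I_s,
          u k (t + c i * h) = u k t + h * c i * (u k)^`() t
          + h ^+ 2 * \sum_(j < s) A i j * (u k)^`(2) (t + c j * h)].

(* z = (y_{n+1}, y'_{n+1}) is a result of one step of size h from
   (tn, yn, dyn). *)
Definition frkn_step (R : realType) (s : nat) (c : 'I_s -> R)
    (u : 'I_s -> R -> R) (f : R * R -> R) (tn yn dyn h : R)
    (z : R * R) : Prop :=
  exists (A : 'M[R]_s) (b d Y : 'I_s -> R),
    [/\ frkn_coeffs c u tn h A b d,
        forall i : 'I_s, Y i = yn + c i * h * dyn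
          + h ^+ 2 * \sum_(j < s) A i j * f (tn + c j * h, Y j),
        z.1 = yn + h * dyn
          + h ^+ 2 * \sum_(i < s) b i * f (tn + c i * h, Y i)
      & z.2 = dyn + h * \sum_(i < s) d i * f (tn + c i * h, Y i)].

(* y is a solution of y'' = f(t, y) on [a, b], with dy = y'. *)
Definition ode2_solution (R : realType) (f : R * R -> R) (a b : R)
    (y dy : R -> R) : Prop :=
  forall t : R, a <= t <= b ->
    is_derive t 1 y (dy t) /\ is_derive t 1 dy (f (t, y t)).

(* Order p at the step point tn.  The first clause of the conclusion says that
   the implicit step is well defined for small h > 0, without which the error
   estimates of the second clause could hold vacuously. *)
Definition frkn_order_at (R : realType) (s : nat) (t0 T : R) (c : 'I_s -> R)
    (u : 'I_s -> R -> R) (f : R * R -> R) (tn : R) (p : nat) : Prop :=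
  forall y dy : R -> R, ode2_solution f t0 (t0 + T) y dy ->
    (\forall h \near (0 : R)^'+,
       exists! z : R * R, frkn_step c u f tn (y tn) (dy tn) h z) /\
    exists p1 p2 : nat, minn p1 p2 = p /\
      forall y1 dy1 : R -> R,
        (\forall h \near (0 : R)^'+,
           frkn_step c u f tn (y tn) (dy tn) h (y1 h, dy1 h)) ->
        (fun h : R => y (tn + h) - y1 h)
          =O_ ((0 : R)^'+) (fun h : R => h ^+ p1.+1) /\
        (fun h : R => dy (tn + h) - dy1 h)
          =O_ ((0 : R)^'+) (fun h : R => h ^+ p2.+1).

(* Wronskian matrix of u_1'', ..., u_s''. The order s + q can fail at a point
   where it is singular, even under the collocation condition: for s = q = 1,
   c_1 = 1/2, u_1(t) = t^3 and t = 0 one gets b = 1/3 for every h > 0, so that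
   for f = 1 the error in y is h^2 / 6. *)
Definition wronskian2_mx (R : realType) (s : nat) (u : 'I_s -> R -> R)
    (t : R) : 'M[R]_s :=
  \matrix_(j, k) (u k)^`(j.+2) t.

(* Main.v *)
Require Import Defs.
From HB Require Import structures.
From mathcomp Require Import all_boot all_order all_algebra.
From mathcomp Require Import all_classical all_reals all_analysis.
From mathcomp Require Import ring lra zify.
Import Order.TTheory GRing.Theory Num.Theory numFieldNormedType.Exports.

Set Implicit Arguments.
Unset Strict Implicit.
Unset Printing Implicit Defensive.

Local Open Scope classical_set_scope.
Local Open Scope ring_scope.

(** The method is collocation in disguise, and collocation at orthogonal nodes
    is superconvergent at the end of the step.

    Fix the step point tn.  The relations that define the coefficients of the
    method are linear in the basis, so u_1, ..., u_s may be recombined with the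
    inverse of the Wronskian matrix of their second derivatives at tn, and the
    first-order Taylor parts removed: this gives functions w_1, ..., w_s with
    w_k(0) = w_k'(0) = 0 and w_k''(t) = t^k / k! + O(t^s).  A step of size h
    then consists in finding U(t) = yn + t y'n + sum_k b_k w_k(t) that solves
    U'' = f(tn + t, U) at the s points t = c_i h, and in returning
    (U(h), U'(h)) ([frkn_stepE]).

    The matrix of the w_k''(c_i h), with column k divided by h^k, tends to the
    invertible matrix of the c_i^k / k!, so for small h the collocation
    equations are a contraction with respect to the norm
    sum_k |h^k b_k| ([nonlinear_stability], [collocation_exists_unique]).
    Comparison with the Taylor coefficients of the exact solution shows that
    the b_k themselves, and not only the h^k b_k, stay bounded as h tends to 0
    ([collocation_bounded]).

    Hence f, the w_k and the exact solution can be replaced by Taylor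
    polynomials F, W_k and P with negligible error: U becomes a polynomial in
    t whose coefficients are bounded uniformly in h.  The error e = P - U then
    satisfies e(0) = e'(0) = 0 and e'' = k e - d, where k and d are polynomials
    with bounded coefficients and the defect d is negligible at the points
    c_i h.  The orthogonality conditions say that the interpolatory quadrature
    rule at the c_i is exact in degree less than s + q, and this makes every
    moment, the integral of t^j d(t) over [0, h], of size O(h^(s+q+1))
    ([small_moments_node_residual]).

    The class of polynomial families with small moments is stable under
    multiplication by t (which shifts the moments) and under antiderivation
    (by parts, the antiderivative of g has moments that are combinations of
    those of g).  Reading the equation for e as e = J(J(k e - d)), with J the
    antiderivative, each use of it improves the moments of e by two powers
    of h until those of d are the only obstacle ([small_moments_ode]).  Since
    e'(h) and e(h) are the zeroth moments of e'' and e', both are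
    O(h^(s+q+1)) ([superconvergence]).  Moments replace here the usual
    variation-of-constants formula and the adjoint solution in it. *)

(** * Antiderivatives and moments of polynomials *)

Section Antiderivative.
Variable R : numFieldType.
Implicit Types p q : {poly R}.

(** The constant coefficient is [p`_0 / 0], which is 0: this is the
    antiderivative that vanishes at 0. *)
Definition antideriv p : {poly R} :=
  \poly_(i < (size p).+1) (p`_i.-1 / i%:R).

Lemma coef_antideriv p i : (antideriv p)`_i = p`_i.-1 / i%:R.
Proof.
rewrite coef_poly; case: ltnP => // sz_p.
by case: i sz_p => // i sz_p; rewrite nth_default ?mul0r.
Qed.

Lemma antideriv_is_linear : linear antideriv.
Proof.
by move=> a p q; apply/polyP=> i;
  rewrite !(coefD, coefZ, coef_antideriv) mulrDl mulrA.
Qed.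

HB.instance Definition _ :=
  GRing.isLinear.Build R {poly R} {poly R} _ antideriv antideriv_is_linear.

Lemma antideriv_deriv p : (antideriv p)^`() = p.
Proof.
by apply/polyP=> i;
  rewrite coef_deriv coef_antideriv /= -(mulr_natr (_ / _)) divfK ?pnatr_eq0.
Qed.

Lemma antideriv0 p : (antideriv p).[0] = 0.
Proof. by rewrite horner_coef0 coef_antideriv invr0 mulr0. Qed.

Lemma eq_from_deriv p q : p^`() = q^`() -> p.[0] = q.[0] -> p = q.
Proof.
rewrite !horner_coef0 => eq_pq' eq_pq0; apply/polyP=> -[//|i].
have /(congr1 (fun r : {poly R} => r`_i)) := eq_pq'.
by rewrite !coef_deriv => /eqP; rewrite eqrMn2r // => /eqP.
Qed.

Lemma deriv_antiderivK p : antideriv p^`() = p - (p.[0])%:P.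
Proof.
apply: eq_from_deriv; first by rewrite antideriv_deriv derivB derivC subr0.
by rewrite antideriv0 hornerD hornerN hornerC subrr.
Qed.

Lemma horner_antideriv n p x : (size p <= n)%N ->
  (antideriv p).[x] = \sum_(k < n) p`_k * (x ^+ k.+1 / k.+1%:R).
Proof.
move=> sz_p; rewrite (@horner_coef_wide _ n.+1); last first.
  by apply: leq_trans (size_poly _ _) _.
rewrite big_ord_recl coef_antideriv invr0 mulr0 mul0r add0r.
by apply: eq_bigr => k _; rewrite coef_antideriv mulrAC -mulrA.
Qed.

(** The integral over [0, x] of t^j p(t). *)
Definition moment j p x := (antideriv ('X^j * p)).[x].

Lemma moment0 p x : moment 0 p x = (antideriv p).[x].
Proof. by rewrite /moment expr0 mul1r. Qed.

(** Integration by parts: it is what makes smallness of all the moments pass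
    from a polynomial to its antiderivative. *)
Lemma moment_antideriv j p x :
  moment j (antideriv p) x =
  (x ^+ j.+1 * moment 0 p x - moment j.+1 p x) / j.+1%:R.
Proof.
have nz : j.+1%:R != 0 :> R by rewrite pnatr_eq0.
have -> : moment j (antideriv p) x = ((j.+1%:R)^-1 *:
    ('X^(j.+1) * antideriv p - antideriv ('X^(j.+1) * p))).[x]; last first.
  by rewrite hornerZ hornerD hornerN hornerM hornerXn moment0 mulrC.
congr (_.[x]); apply: eq_from_deriv.
  rewrite antideriv_deriv derivZ derivB derivM !antideriv_deriv addrK.
  by rewrite derivXn /= -(scaler_nat _ 'X^j) -scalerAl scalerA mulVf ?scale1r.
by rewrite hornerZ hornerD hornerN hornerM !antideriv0 mulr0 subr0 mulr0.
Qed.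

Lemma moment_wide n j p x : (size p <= n)%N ->
  moment j p x = \sum_(k < n) p`_k * (x ^+ (j + k).+1 / (j + k).+1%:R).
Proof.
move=> sz_p; rewrite /moment (@horner_antideriv (j + n)).
  rewrite big_split_ord /= big1 ?add0r; last first.
    by move=> k _; rewrite coefXnM ltn_ord mul0r.
  by apply: eq_bigr => k _; rewrite coefXnM ltnNge leq_addr /= addKn.
rewrite (leq_trans (size_polyMleq _ _))//.
by rewrite size_polyXn addSn /= leq_add2l.
Qed.

End Antiderivative.

(** * Families of polynomials, uniformly in the step size *)

Section UniformFamilies.
Variables (R : realFieldType) (I : Type) (h : I -> R).
Hypothesis h_gt0 : forall i, 0 < h i.
Hypothesis h_le1 : forall i, h i <= 1.
Implicit Types (f g : I -> R) (p q : I -> {poly R}).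

(** An index stands for one step of the method, of size [h i], together with
    the data it produces.  Quantifying the constant before the index makes the
    estimates uniform over all the steps, without choosing one per size. *)
Definition unifO m g := exists C, forall i, `|g i| <= C * h i ^+ m.

Lemma hX_ge0 m i : 0 <= h i ^+ m. Proof. exact/exprn_ge0/ltW. Qed.

Lemma unifO_pos m g : unifO m g ->
  exists2 C, 0 <= C & forall i, `|g i| <= C * h i ^+ m.
Proof.
case=> C gC; exists `|C| => // i; apply: le_trans (gC i) _.
by apply: ler_wpM2r (ler_norm C); exact: hX_ge0.
Qed.

Lemma eq_unifO m f g : f =1 g -> unifO m f -> unifO m g.
Proof. by move=> fg [C fC]; exists C => i; rewrite -fg. Qed.

Lemma unifO_le m n g : (n <= m)%N -> unifO m g -> unifO n g.
Proof.
move=> le_nm /unifO_pos[C C0 gC]; exists C => i; apply: le_trans (gC i) _.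
apply: ler_wpM2l => //.
by apply: ler_wiXn2l => //; exact: ltW.
Qed.

Lemma unifOD m f g : unifO m f -> unifO m g -> unifO m (fun i => f i + g i).
Proof.
move=> [C fC] [D gD]; exists (C + D) => i.
by rewrite mulrDl (le_trans (ler_normD _ _))// lerD.
Qed.

Lemma unifON m f : unifO m f -> unifO m (fun i => - f i).
Proof. by move=> [C fC]; exists C => i; rewrite normrN. Qed.

Lemma unifOM m n f g : unifO m f -> unifO n g ->
  unifO (m + n) (fun i => f i * g i).
Proof.
move=> [C fC] [D gD]; exists (C * D) => i.
by rewrite normrM exprD mulrACA ler_pM.
Qed.

Lemma unifO_cst a : unifO 0 (fun=> a).
Proof. by exists `|a| => i; rewrite expr0 mulr1. Qed.

Lemma unifO0 m : unifO m (fun=> 0).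
Proof. by exists 0 => i; rewrite normr0 mul0r. Qed.

Lemma unifOX n : unifO n (fun i => h i ^+ n).
Proof. by exists 1 => i; rewrite mul1r ger0_norm ?hX_ge0. Qed.

Lemma unifOMc m a f : unifO m f -> unifO m (fun i => a * f i).
Proof. by move=> /(unifOM (unifO_cst a)). Qed.

Lemma unifO_sum m (J : Type) (r : seq J) (P : pred J) (F : J -> I -> R) :
  (forall j, P j -> unifO m (F j)) ->
  unifO m (fun i => \sum_(j <- r | P j) F j i).
Proof.
move=> FO; elim: r => [|j r IHr].
  by apply: eq_unifO (unifO0 m) => i; rewrite big_nil.
case Pj : (P j); last by apply: eq_unifO IHr => i; rewrite big_cons Pj.
by apply: eq_unifO (unifOD (FO _ Pj) IHr) => i; rewrite big_cons Pj.
Qed.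

(** The degrees must be bounded as well, so that sums over coefficients do not
    lose uniformity. *)
Definition bounded_family p :=
  exists2 n, (forall i, (size (p i) <= n)%N) &
             forall k, unifO 0 (fun i => (p i)`_k).

Lemma eq_bounded_family p q : p =1 q -> bounded_family p -> bounded_family q.
Proof.
move=> pq [n sz_p bd_p]; exists n => [i|k]; first by rewrite -pq.
by apply: eq_unifO (bd_p k) => i; rewrite pq.
Qed.

Lemma bounded_family_cst (p : {poly R}) : bounded_family (fun=> p).
Proof. by exists (size p) => // k; exact: unifO_cst. Qed.

Lemma bounded_familyD p q :
  bounded_family p -> bounded_family q -> bounded_family (fun i => p i + q i).
Proof.
move=> [n sz_p bd_p] [m sz_q bd_q]; exists (maxn n m) => [i|k].
  by rewrite (leq_trans (size_polyD _ _))// geq_max !leq_max sz_p sz_q orbT.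
by apply: eq_unifO (unifOD (bd_p k) (bd_q k)) => i; rewrite coefD.
Qed.

Lemma bounded_familyZ g p : unifO 0 g ->
  bounded_family p -> bounded_family (fun i => g i *: p i).
Proof.
move=> bd_g [n sz_p bd_p]; exists n => [i|k].
  by rewrite (leq_trans (size_scale_leq _ _)).
by apply: eq_unifO (unifOM bd_g (bd_p k)) => i; rewrite coefZ.
Qed.

Lemma bounded_familyN p :
  bounded_family p -> bounded_family (fun i => - p i).
Proof.
move=> [n sz_p bd_p]; exists n => [i|k]; first by rewrite size_polyN.
by apply: eq_unifO (unifON (bd_p k)) => i; rewrite coefN.
Qed.

Lemma bounded_familyM p q :
  bounded_family p -> bounded_family q -> bounded_family (fun i => p i * q i).
Proof.
move=> [n sz_p bd_p] [m sz_q bd_q]; exists (n + m)%N => [i|k].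
  rewrite (leq_trans (size_polyMleq _ _))// (leq_trans (leq_pred _))//.
  exact: leq_add.
apply: (@eq_unifO _ (fun i => \sum_(j < k.+1) (p i)`_j * (q i)`_(k - j))).
  by move=> i; rewrite coefM.
by apply: unifO_sum => j _; apply: unifOM (bd_p _) (bd_q _).
Qed.

Lemma bounded_familyX p n :
  bounded_family p -> bounded_family (fun i => p i ^+ n).
Proof.
move=> bd_p; elim: n => [|n IHn]; first exact: bounded_family_cst.
by apply: eq_bounded_family (bounded_familyM bd_p IHn) => i; rewrite exprS.
Qed.

Lemma bounded_family_sum (J : Type) (r : seq J) (F : J -> I -> {poly R}) :
  (forall j, bounded_family (F j)) ->
  bounded_family (fun i => \sum_(j <- r) F j i).
Proof.
move=> bdF; elim: r => [|j r IHr].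
  apply: eq_bounded_family (bounded_family_cst 0) => i.
  by rewrite big_nil.
apply: eq_bounded_family (bounded_familyD (bdF j) IHr) => i.
by rewrite big_cons.
Qed.

Lemma bounded_family_deriv p :
  bounded_family p -> bounded_family (fun i => (p i)^`()).
Proof.
move=> [n sz_p bd_p]; exists n => [i|k].
  by rewrite (leq_trans (size_poly _ _))// (leq_trans (leq_pred _)).
apply: eq_unifO (unifOMc k.+1%:R (bd_p k.+1)) => i.
by rewrite coef_deriv mulr_natl.
Qed.

Lemma bounded_family_horner (F : {poly {poly R}}) p :
  bounded_family p -> bounded_family (fun i => F.[p i]).
Proof.
move=> bd_p.
apply: (@eq_bounded_family (fun i => \sum_(j < size F) F`_j * p i ^+ j)).
  by move=> i; rewrite horner_coef.
apply: bounded_family_sum => j; apply: bounded_familyM.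
  exact: bounded_family_cst.
exact: bounded_familyX.
Qed.

(** Linearization: the difference of the values of a bivariate polynomial at
    two families is a multiple of the difference of the families, with a
    bounded quotient.  For a polynomial approximation of the right-hand side
    of an equation it replaces the mean value theorem. *)
Lemma horner_bounded_divides (F : {poly {poly R}}) p q :
  bounded_family p -> bounded_family q ->
  exists2 k, bounded_family k &
    forall i, F.[p i] - F.[q i] = k i * (p i - q i).
Proof.
move=> bd_p bd_q.
exists (fun i => \sum_(j < size F) \sum_(a < j)
    F`_j * (p i ^+ (j.-1 - a) * q i ^+ a)).
  apply: bounded_family_sum => j; apply: bounded_family_sum => a.
  apply: bounded_familyM; first exact: bounded_family_cst.
  by apply: bounded_familyM; exact: bounded_familyX.
move=> i; rewrite !horner_coef -sumrB mulr_suml; apply: eq_bigr => j _.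
rewrite -mulrBr subrXX -mulr_sumr -mulrA; congr (_ * _).
by rewrite mulrC; congr (_ * _); apply: eq_bigr => a _.
Qed.

Section MomentFiltration.
Variable m : nat.

(** Up to the ceiling [m], the [j]-th moment has the size that an integrand of
    size h^(r-1) would give it.  Letting the exponent grow with [j] is what
    makes the antiderivative gain a power of h: the term with the moment
    [j.+1] in the integration by parts is then as small as the other one. *)
Definition small_moments r p :=
  forall j, unifO (minn m (r + j)) (fun i => moment j (p i) (h i)).

Lemma small_moments_le r r' p : (r' <= r)%N ->
  small_moments r p -> small_moments r' p.
Proof.
move=> le_r pr j; apply: unifO_le (pr j).
by rewrite leq_min geq_minl (leq_trans (geq_minr _ _))// leq_add2r.
Qed.

Lemma small_momentsD r p q : small_moments r p -> small_moments r q ->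
  small_moments r (fun i => p i + q i).
Proof.
move=> pr qr j; apply: eq_unifO (unifOD (pr j) (qr j)) => i.
by rewrite /moment mulrDr linearD hornerD.
Qed.

Lemma small_moments_bounded p : bounded_family p -> small_moments 0 p.
Proof.
move=> [n sz_p bd_p] j.
apply: (@eq_unifO _ (fun i => \sum_(k < n) (p i)`_k *
   (h i ^+ (j + k).+1 / (j + k).+1%:R))) => [i|].
  by rewrite (moment_wide _ _ (sz_p i)).
apply: unifO_sum => k _.
apply: (@unifO_le (0 + (j + k).+1)); first by rewrite geq_min; lia.
apply: unifOM (bd_p k) _.
by apply: eq_unifO (unifOMc (j + k).+1%:R^-1 (unifOX _)) => i; rewrite mulrC.
Qed.

Lemma small_momentsM r k p : bounded_family k -> small_moments r p ->
  small_moments r (fun i => k i * p i).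
Proof.
move=> [n sz_k bd_k] pr j.
apply: (@eq_unifO _ (fun i => \sum_(l < n) (k i)`_l *
   moment (j + l) (p i) (h i))) => [i|].
  transitivity (moment j ((\sum_(l < n) (k i)`_l *: 'X^l) * p i) (h i)).
    rewrite /moment mulr_suml mulr_sumr linear_sum horner_sum.
    apply: eq_bigr => l _; rewrite -hornerZ -linearZ; congr (antideriv _).[_].
    by rewrite exprD -mulrA -scalerAl -scalerAr.
  congr (moment _ (_ * _) _); rewrite -poly_def; apply/polyP => l.
  by rewrite coef_poly;
  case: ltnP => // /(leq_trans (sz_k i)) le_l; rewrite nth_default.
apply: unifO_sum => l _.
apply: (@unifO_le (0 + minn m (r + (j + l)))); first by lia.
exact: unifOM.
Qed.

Lemma small_moments_antideriv r p : small_moments r p ->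
  small_moments r.+1 (fun i => antideriv (p i)).
Proof.
move=> pr j; have p0 := pr 0; have p1 := pr j.+1.
apply: (@eq_unifO _ (fun i => j.+1%:R^-1 * (h i ^+ j.+1 * moment 0 (p i) (h i)
  + - moment j.+1 (p i) (h i)))) => [i|].
  by rewrite moment_antideriv mulrC.
apply/unifOMc/unifOD; last by apply/unifON; apply: unifO_le p1; lia.
by apply: unifO_le (unifOM (unifOX j.+1) p0); lia.
Qed.

(** The equation is used as a bootstrap: boundedness of [e] starts it, and one
    pass through the equation turns smallness to order [r] into smallness to
    order [r + 2], as far as the forcing term [d] allows. *)
Theorem small_moments_ode e k d :
  bounded_family e -> bounded_family k -> small_moments m d ->
  (forall i, e i = antideriv (antideriv (k i * e i + d i))) ->
  unifO m (fun i => (e i).[h i]) /\ unifO m (fun i => (e i)^`().[h i]).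
Proof.
move=> bd_e bd_k dm eE.
have step r : small_moments (minn m r) e ->
    small_moments (minn m r) (fun i => k i * e i + d i).
  move=> er; apply: small_momentsD; first exact: small_momentsM.
  by apply: small_moments_le dm; exact: geq_minl.
have eq_sm r p q : p =1 q -> small_moments r p -> small_moments r q.
  by move=> pq pr j; apply: eq_unifO (pr j) => i; rewrite pq.
have er r : small_moments (minn m r) e.
  elim: r => [|r IHr]; first by rewrite minn0; exact: small_moments_bounded.
  have := small_moments_antideriv (small_moments_antideriv (step _ IHr)).
  move=> /(@small_moments_le _ (minn m r.+1)) er.
  apply: (eq_sm _ (fun i => antideriv (antideriv (k i * e i + d i)))) => //.
  by apply: er; lia.
have gm := step _ (er m).
have jm := small_moments_antideriv gm.
split.
  apply: eq_unifO (unifO_le _ (jm 0)) => [i|]; last by lia.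
  by rewrite moment0 -eE.
apply: eq_unifO (unifO_le _ (gm 0)) => [i|]; last by lia.
by rewrite moment0 [in RHS]eE antideriv_deriv.
Qed.

End MomentFiltration.
End UniformFamilies.

(** * Interpolatory quadrature *)

Section Quadrature.
Variables (R : numFieldType) (s : nat) (c : 'I_s -> R).
Hypothesis c_inj : injective c.

Definition node_poly : {poly R} := \prod_(i < s) ('X - (c i)%:P).

Definition lagrange_poly i : {poly R} :=
  \prod_(j < s | j != i) ((c i - c j)^-1 *: ('X - (c j)%:P)).

Lemma size_lagrange_poly i : (size (lagrange_poly i) <= s)%N.
Proof.
apply: leq_trans (size_poly_prod_leq _ _) _ => /=.
have le1 : (\sum_(j < s | j != i) size ((c i - c j)^-1 *: ('X - (c j)%:P))
    <= \sum_(j < s | j != i) 2)%N.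
  apply: leq_sum => j _.
  by rewrite (leq_trans (size_scale_leq _ _))// size_XsubC.
move: le1; rewrite leq_subLR sum_nat_const cardC1 card_ord.
have := ltn_ord i; set a := (\sum_(_ < _ | _) _)%N; lia.
Qed.

Lemma lagrange_poly_node i j : (lagrange_poly i).[c j] = (i == j)%:R.
Proof.
rewrite /lagrange_poly horner_prod; case: eqVneq => [<-|neq_ij].
  rewrite big1 // => k neq_ki.
  by rewrite !hornerE mulVf // subr_eq0 (inj_eq c_inj) eq_sym.
by rewrite (bigD1 j) 1?eq_sym //= !hornerE subrr mulr0 mul0r.
Qed.

Lemma node_poly_node i : node_poly.[c i] = 0.
Proof.
by rewrite horner_prod (bigD1 i) //= hornerXsubC subrr mul0r.
Qed.

Lemma size_node_poly : size node_poly = s.+1.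
Proof. by rewrite size_prod_XsubC -[in RHS](size_enum_ord s) ?enumT. Qed.

Lemma interpolationE (p : {poly R}) : (size p <= s)%N ->
  p = \sum_i p.[c i] *: lagrange_poly i.
Proof.
move=> sz_p; apply/eqP; rewrite -subr_eq0; apply/eqP.
apply: (@roots_geq_poly_eq0 _ _ (codom c)).
- apply/allP => _ /codomP[j ->]; rewrite rootE hornerD hornerN horner_sum.
  rewrite (bigD1 j) //= big1 => [|i neq_ij].
    by rewrite hornerZ lagrange_poly_node eqxx mulr1 addr0 subrr.
  by rewrite hornerZ lagrange_poly_node (negbTE neq_ij) mulr0.
- by rewrite map_inj_uniq ?enum_uniq.
rewrite size_codom card_ord (leq_trans (size_polyD _ _)) // size_polyN geq_max.
rewrite sz_p; apply: (leq_trans (size_sum _ _ _)).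
apply/bigmax_leqP => i _.
by rewrite (leq_trans (size_scale_leq _ _)) ?size_lagrange_poly.
Qed.

Definition quad_weight i := (antideriv (lagrange_poly i)).[1].

(** Divide by the node polynomial: the quotient has degree less than [q], so
    the orthogonality kills its contribution, and the remainder is recovered
    by interpolation. *)
Lemma quadrature_exact q (p : {poly R}) :
  (forall j, (j < q)%N -> moment j node_poly 1 = 0) ->
  (size p <= s + q)%N ->
  (antideriv p).[1] = \sum_i quad_weight i * p.[c i].
Proof.
move=> orth sz_p.
have nz : node_poly != 0 by rewrite -size_poly_gt0 size_node_poly.
rewrite [p in LHS](divp_eq p node_poly) linearD hornerD.
have -> : (antideriv (p %/ node_poly * node_poly)).[1] = 0.
  rewrite -[p %/ _]coefK poly_def mulr_suml linear_sum horner_sum big1 // => j _.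
  rewrite -scalerAl linearZ hornerZ -/(moment j _ _) orth ?mulr0 //.
  apply: leq_trans (ltn_ord j) _.
  by rewrite size_divp // size_node_poly leq_subLR.
rewrite add0r [p %% _ in LHS]interpolationE; last first.
  by rewrite -ltnS -size_node_poly ltn_modp.
rewrite linear_sum horner_sum; apply: eq_bigr => i _.
rewrite linearZ hornerZ mulrC; congr (_ * _).
rewrite [p in RHS](divp_eq p node_poly) hornerD hornerM node_poly_node.
by rewrite mulr0 add0r.
Qed.
End Quadrature.

Section Superconvergence.
Variables (R : realFieldType) (s q : nat) (c : 'I_s -> R).
Hypothesis c_inj : injective c.
Hypothesis orth : forall j, (j < q)%N -> moment j (node_poly c) 1 = 0.
Variables (I : Type) (h : I -> R).
Hypothesis h_gt0 : forall i, 0 < h i.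
Hypothesis h_le1 : forall i, h i <= 1.

(** Compare the [j]-th moment of [d] with the quadrature rule applied to
    t^j d(t): on the monomials of degree less than [s + q] both agree, the
    other monomials contribute O(h^(s+q+1)) to each, and the value of the rule
    is negligible since [d] is negligible at the nodes. *)
Lemma small_moments_node_residual (d : I -> {poly R}) :
  bounded_family h d ->
  (forall i, unifO h (s + q) (fun x => (d x).[c i * h x])) ->
  small_moments h (s + q).+1 (s + q).+1 d.
Proof.
move=> [n sz_d bd_d] d_node j.
pose E k := (j + k).+1%:R^-1 - \sum_i quad_weight c i * c i ^+ (j + k).
apply: (@eq_unifO _ _ _ _ (fun x =>
    h x ^+ j.+1 * (\sum_i (quad_weight c i * c i ^+ j) * (d x).[c i * h x]) +
    \sum_(k < n) (d x)`_k * (E k * h x ^+ (j + k).+1))) => [x|].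
  rewrite (moment_wide _ _ (sz_d x)) mulr_sumr.
  under eq_bigr => i _.
    rewrite (horner_coef_wide _ (sz_d x)) mulr_sumr mulr_sumr; over.
  rewrite exchange_big -big_split /=; apply: eq_bigr => k _.
  rewrite /E mulrBl mulrBr addrC mulr_suml mulr_sumr.
  rewrite [X in _ - X + _](_ : _ = \sum_(i < s)
     h x ^+ j.+1 * (quad_weight c i * c i ^+ j * ((d x)`_k * (c i * h x) ^+ k))).
    by rewrite subrK [_^-1 * _]mulrC.
  by apply: eq_bigr => i _; rewrite exprMn -addSn !exprD; ring.
apply: unifOD.
  apply: (@unifO_le _ _ _ _ _ (j.+1 + (s + q))) => //; first by lia.
  apply: unifOM; first exact: unifOX.
  by apply: unifO_sum => // i _; apply: unifOMc.
apply: unifO_sum => // k _; rewrite -[minn _ _]add0n; apply: unifOM => //.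
rewrite (minn_idPl (leq_addr _ _)).
case: (ltnP (j + k) (s + q)) => [lt_jk|le_jk].
  apply: eq_unifO (unifO0 h _) => x.
  have sz : (size ('X^(j + k) : {poly R}) <= s + q)%N by rewrite size_polyXn.
  have := quadrature_exact c_inj orth sz.
  rewrite (@horner_antideriv _ (j + k).+1) ?size_polyXn // big_ord_recr /=.
  rewrite big1 => [|l _]; last by rewrite coefXn ltn_eqF ?mul0r.
  rewrite coefXn eqxx mul1r expr1n mul1r add0r => quad.
  rewrite /E quad (eq_bigr _ (fun i _ => congr1 _ (hornerXn _ _))).
  by rewrite subrr mul0r.
by apply/unifOMc; apply: (@unifO_le _ _ _ _ _ (j + k).+1) => //; exact: unifOX.
Qed.

Lemma small_moments_Xn (r : {poly R}) m :
  small_moments h m m (fun=> 'X^m * r).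
Proof.
move=> j; rewrite (minn_idPl (leq_addr _ _)).
have := small_moments_bounded h_gt0 h_le1 (j + m) (bounded_family_cst h r).
move=> /(_ (j + m)%N); rewrite add0n minnn => rO.
apply: eq_unifO (@unifO_le _ _ _ h_gt0 h_le1 _ m _ _ rO) => [x|].
  by rewrite /moment exprD mulrA.
exact: leq_addl.
Qed.

(** Here [P] solves the polynomial equation y'' = F(t, y - y0) up to t^m, and
    [U] is a family that solves it only at the nodes [c i * h]; [F.[p]] is the
    polynomial F(t, p(t)). *)
Theorem superconvergence (y0 : R) (F : {poly {poly R}}) (P r : {poly R})
    (U : I -> {poly R}) :
  let m := (s + q).+1 in
  P^`(2) - F.[P - y0%:P] = 'X^m * r ->
  bounded_family h U ->
  (forall x, (U x).[0] = P.[0]) ->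
  (forall x, (U x)^`().[0] = P^`().[0]) ->
  (forall i, unifO h (s + q) (fun x =>
     ((U x)^`(2) - F.[U x - y0%:P]).[c i * h x])) ->
  unifO h m (fun x => (P - U x).[h x]) /\
  unifO h m (fun x => (P - U x)^`().[h x]).
Proof.
move=> m PE bdU U0 dU0 U_node.
have bdN0 : bounded_family h (fun=> - y0%:P) by exact: bounded_family_cst.
have bdP : bounded_family h (fun=> P - y0%:P) by exact: bounded_family_cst.
have bdU' : bounded_family h (fun x => U x - y0%:P) by exact: bounded_familyD.
have [k bdk kE] := horner_bounded_divides F bdP bdU'.
pose d x := (U x)^`(2) - F.[U x - y0%:P].
have bdd : bounded_family h d.
  apply: bounded_familyD; first by do 2!apply: bounded_family_deriv.
  by apply/bounded_familyN/bounded_family_horner.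
have d_small := small_moments_node_residual bdd U_node.
apply: (@small_moments_ode _ _ h h_gt0 h_le1 m (fun x => P - U x) k
    (fun x => 'X^m * r + -1 *: d x)) => //.
- by apply: bounded_familyD; [exact: bounded_family_cst | exact: bounded_familyN].
- apply: small_momentsD; first exact: small_moments_Xn.
  move=> j; apply: eq_unifO (unifON (d_small j)) => x.
  by rewrite /moment scaleN1r mulrN linearN hornerN.
move=> x.
have -> : k x * (P - U x) + ('X^m * r + -1 *: d x) = (P - U x)^`()^`().
  rewrite -PE -[P - U x](_ : (P - y0%:P) - (U x - y0%:P) = _); last first.
    by rewrite opprB addrA subrK.
  rewrite -kE !(derivB, derivC, subr0) scaleN1r /d /derivn /=.
  by rewrite opprB; set a := F.[_]; set b := F.[_]; ring.
have e0 : (P - U x).[0] = 0 by rewrite hornerD hornerN U0 subrr.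
have de0 : (P - U x)^`().[0] = 0 by rewrite derivB hornerD hornerN dU0 subrr.
by rewrite deriv_antiderivK de0 subr0 deriv_antiderivK e0 subr0.
Qed.
End Superconvergence.

(** * Integration of bounds and Taylor expansion *)

Section Calculus.
Variable R : realType.
Implicit Types (g dg : R -> R) (e C t : R).

Lemma is_derive_line (V : normedModType R) (f : V -> R) (p v : V) t :
  derivable f (p + t *: v) v ->
  is_derive t (1 : R) (fun x => f (p + x *: v)) ('D_v f (p + t *: v)).
Proof.
move=> df.
have eqf : (fun h : R => h^-1 *:
    (((fun x => f (p + x *: v)) \o shift t) (h *: 1) - f (p + t *: v))) =
  (fun h : R => h^-1 *: ((f \o shift (p + t *: v)) (h *: v) - f (p + t *: v))).
  apply/funext => h /=; congr (_ *: (f _ - _)).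
  by rewrite scaler1 scalerDl addrCA.
by split; rewrite /derivable /derive eqf.
Qed.

Lemma is_derive_add_const (f : R -> R) a t df :
  is_derive (a + t) (1 : R) f df -> is_derive t (1 : R) (fun x => f (a + x)) df.
Proof.
case=> df1 dfE; have e1 x : x *: (1 : R) = x by rewrite scaler1.
have := @is_derive_line R f a (1 : R) t; rewrite e1 dfE => /(_ df1).
by under [fun x => f _]funext => x do rewrite e1.
Qed.

Lemma is_deriveB_fun (f g : R -> R) t (df dg : R) :
  is_derive t (1 : R) f df -> is_derive t (1 : R) g dg ->
  is_derive t (1 : R) (fun x => f x - g x) (df - dg).
Proof. exact: is_deriveB. Qed.

(** The one-sided form is required for the exact solution, about which nothing
    is known to the left of the initial time. *)
Lemma integrate_bound g dg e C r : 0 <= C ->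
  (forall t, 0 <= t <= e -> is_derive t (1 : R) g (dg t)) -> g 0 = 0 ->
  (forall t, 0 <= t <= e -> `|dg t| <= C * t ^+ r) ->
  forall t, 0 <= t <= e -> `|g t| <= C * t ^+ r.+1.
Proof.
move=> C0 gd g0 dgC t /andP[t0 te].
have gd' x : x \in `]0, t[%R -> is_derive x (1 : R) g (dg x).
  rewrite in_itv /= => /andP[x0 xt]; apply: gd.
  by rewrite ltW //= (le_trans (ltW xt)).
have gc : {within `[0, t], continuous g}.
  apply: derivable_within_continuous => x; rewrite in_itv /= => /andP[x0 xt].
  by have [] := gd x; rewrite ?x0 ?(le_trans xt).
have [x] := MVT_segment t0 gd' gc.
rewrite in_itv /= => /andP[x0 xt]; rewrite g0 !subr0 => ->.
rewrite normrM exprSr mulrA (ger0_norm t0) ler_wpM2r //.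
apply: le_trans (dgC x _) _; first by rewrite x0 (le_trans xt).
by rewrite ler_wpM2l // lerXn2r ?nnegrE.
Qed.

Lemma integrate_bound2 g dg e C r : 0 <= C ->
  (forall t, `|t| <= e -> is_derive t (1 : R) g (dg t)) -> g 0 = 0 ->
  (forall t, `|t| <= e -> `|dg t| <= C * `|t| ^+ r) ->
  forall t, `|t| <= e -> `|g t| <= C * `|t| ^+ r.+1.
Proof.
move=> C0 gd g0 dgC t te.
have [t0|t0] := leP 0 t.
  rewrite ger0_norm // in te *; apply: (@integrate_bound g dg e) => //.
  - by move=> x /andP[x0 xe]; apply: gd; rewrite ger0_norm.
  - by move=> x /andP[x0 xe]; rewrite -{2}(ger0_norm x0) dgC // ger0_norm.
  - by rewrite t0.
rewrite ltr0_norm // in te *.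
have -> : g t = g (- - t) by rewrite opprK.
apply: (@integrate_bound (fun x => g (- x)) (fun x => - dg (- x)) e) => //.
- move=> x /andP[x0 xe].
  have gdx : is_derive (- x) (1 : R) g (dg (- x)).
    by apply: gd; rewrite normrN ger0_norm.
  apply: is_derive_eq (is_derive1_comp gdx (is_deriveNid x 1)) _.
  by rewrite mulrN1.
- by rewrite oppr0.
- move=> x /andP[x0 xe]; rewrite normrN -{2}(ger0_norm x0) -(normrN x) dgC //.
  by rewrite normrN ger0_norm.
- by rewrite oppr_ge0 (ltW t0).
Qed.

Definition taylor_poly n (G : nat -> R -> R) : {poly R} :=
  \poly_(j < n) (G j 0 / j`!%:R).

Lemma deriv_taylor_poly n G :
  (taylor_poly n.+1 G)^`() = taylor_poly n (fun j => G j.+1).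
Proof.
apply/polyP => j; rewrite coef_deriv !coef_poly ltnS.
case: ifP => _; last by rewrite mul0rn.
rewrite factS natrM invfM -mulr_natr; field.
by rewrite nat1r !pnatr_eq0 -!lt0n fact_gt0.
Qed.

Lemma taylor_bound n G e C : 0 <= e ->
  (forall k t, (k < n)%N -> `|t| <= e -> is_derive t (1 : R) (G k) (G k.+1 t)) ->
  (forall t, `|t| <= e -> `|G n t| <= C) ->
  forall t, `|t| <= e -> `|G 0%N t - (taylor_poly n G).[t]| <= C * `|t| ^+ n.
Proof.
move=> e0; elim: n G => [|n IHn] G Gd GC.
  move=> t te; rewrite /taylor_poly poly_def big_ord0 horner0 subr0.
  by rewrite expr0 mulr1 GC.
apply: (@integrate_bound2 _ (fun t => G 1%N t -
   (taylor_poly n (fun j => G j.+1)).[t])).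
- by apply: le_trans (GC 0 _); rewrite ?normr0.
- move=> t te; apply: is_deriveB_fun; first exact: Gd.
  by rewrite -deriv_taylor_poly; exact: is_derive_poly.
- by rewrite horner_coef0 coef_poly /= fact0 divr1 subrr.
by apply: IHn => // k t kn te; apply: Gd.
Qed.

End Calculus.

(** * Consequences of smoothness *)

Section Smoothness.
Variable R : realType.

Lemma class_C_continuous (V : normedModType R) n (f : V -> R) :
  class_C n f -> continuous f.
Proof. by case: n => [|n] []. Qed.

Lemma class_C_iter (V : normedModType R) v k n (f : V -> R) :
  class_C (k + n) f -> class_C n (iter k (fun g x => 'D_v g x) f).
Proof.
elim: k n f => [//|k IHk] n f; rewrite addSnnS => /IHk.
by rewrite iterS => -[_ /(_ v)[]].
Qed.

Lemma class_C_iter_derivable (V : normedModType R) v k N (f : V -> R) x :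
  class_C N f -> (k < N)%N -> derivable (iter k (fun g x => 'D_v g x) f) x v.
Proof.
move=> fC kN; move: fC; rewrite -(subnKC kN) addSnnS => /(class_C_iter v) /=.
by case=> _ /(_ v)[].
Qed.

Lemma class_C_iter_continuous (V : normedModType R) v k N (f : V -> R) :
  class_C N f -> (k <= N)%N -> continuous (iter k (fun g x => 'D_v g x) f).
Proof.
move=> fC kN; move: fC; rewrite -(subnKC kN).
by move=> /(class_C_iter v)/class_C_continuous.
Qed.

Lemma class_C_le (V : normedModType R) m n (f : V -> R) :
  (m <= n)%N -> class_C n f -> class_C m f.
Proof.
elim: m n f => [|m IHm] [|n] f //= => [_ []//|lt_mn [cf df]]; split => // v.
by have [dfv /(IHm _ _ lt_mn)] := df v.
Qed.

Lemma derive1nE_iter k (g : R -> R) :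
  derive1n k g = iter k (fun g x => 'D_(1 : R) g x) g.
Proof.
elim: k => [//|k IHk]; rewrite derive1nS IHk iterS.
by apply/funext => x; rewrite derive1E.
Qed.

Lemma class_C_is_derive1n k N (g : R -> R) t :
  class_C N g -> (k < N)%N ->
  is_derive t (1 : R) (derive1n k g) (derive1n k.+1 g t).
Proof.
move=> gC kN; rewrite derive1nS derive1E; apply: derivableP.
by rewrite derive1nE_iter; exact: class_C_iter_derivable gC kN.
Qed.

Lemma class_C_derive1n_continuous k N (g : R -> R) :
  class_C N g -> (k <= N)%N -> continuous (derive1n k g).
Proof. by rewrite derive1nE_iter; exact: class_C_iter_continuous. Qed.

Lemma continuous_locally_bounded (V : normedModType R) (g : V -> R) p :
  {for p, continuous g} -> \forall x \near p, `|g x| <= `|g p| + 1.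
Proof.
move=> /cvgrPdist_le /(_ 1 ltr01); apply: filterS => x gx.
by rewrite -lerBlDl (le_trans (lerB_dist _ _)) // distrC.
Qed.

Lemma near_prod_box (P : R * R -> Prop) t y : (\forall x \near (t, y), P x) ->
  exists2 e : R, 0 < e <= 1 &
    forall a b, `|a| <= e -> `|b| <= e -> P (t + a, y + b).
Proof.
move=> /nbhs_ballP[e /= e0 Pe].
exists (Num.min (e / 2) 1) => [|a b].
  by rewrite lt_min ge_min lexx orbT divr_gt0 ?ltr01.
rewrite !le_min => /andP[ae _] /andP[be _]; apply: Pe; split => /=.
  by rewrite /ball /= opprD addNKr normrN; lra.
by rewrite /ball /= opprD addNKr normrN; lra.
Qed.

(** Expand first in the second variable, then each coefficient in the first
    one.  In this order only derivatives iterated along one axis and then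
    along the other occur, and these are what [class_C] provides directly. *)
Lemma bivariate_taylor K (f : R * R -> R) t y : class_C (K + K) f ->
  exists F : {poly {poly R}}, exists2 e, 0 < e <= 1 & exists2 C, 0 <= C &
    forall a b, `|a| <= e -> `|b| <= e ->
      `|f (t + a, y + b) - F.[b%:P].[a]| <= C * (`|a| ^+ K + `|b| ^+ K).
Proof.
move=> fC; pose e1 : R * R := (1, 0); pose e2 : R * R := (0, 1).
pose f2 i := iter i (fun g x => 'D_e2 g x) f.
pose f21 i j := iter j (fun g x => 'D_e1 g x) (f2 i).
have f2C i : (i <= K)%N -> class_C K (f2 i).
  move=> iK; apply: class_C_iter; move: fC.
  by apply: class_C_le; rewrite leq_add2r.
pose bd (i : 'I_K.+1) x := (`|f2 K x| <= `|f2 K (t, y)| + 1) /\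
  `|f21 i K x| <= `|f21 i K (t, y)| + 1.
have /near_prod_box[e e01 ebd] : \forall x \near (t, y), forall i, bd i x.
  apply: (@filter_forall _ _ bd (nbhs (t, y)) _) => i.
  have c2 : {for (t, y), continuous (f2 K)}.
    by have /class_C_continuous := f2C K (leqnn K); exact.
  have c21 : {for (t, y), continuous (f21 i K)}.
    by have /class_C_iter_continuous /(_ (leqnn K)) := f2C i (leq_ord i); exact.
  have A2 := continuous_locally_bounded c2.
  have A21 := continuous_locally_bounded c21.
  by near=> x; split; near: x.
have [e0 e1'] := andP e01.
pose T i := taylor_poly K (fun j a => f21 i j (t + a, y)).
pose F : {poly {poly R}} := \poly_(i < K) (i`!%:R^-1 *: T i).
exists F, e => //.
pose C1 i : R := `|f21 i K (t, y)| + 1.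
pose C2 : R := `|f2 K (t, y)| + 1.
have C1_ge0 i : 0 <= C1 i by rewrite addr_ge0.
exists (C2 + \sum_(i < K) C1 i) => [|a b ae be].
  by rewrite addr_ge0 ?sumr_ge0 // addr_ge0.
have E1 x : (t, y) + x *: e1 = (t + x, y).
  by congr pair; rewrite /= ?scaler1 // scaler0 addr0.
have E2 x : (t + a, y) + x *: e2 = (t + a, y + x).
  by congr pair; rewrite /= ?scaler1 // scaler0 addr0.
have T1 i : (i <= K)%N -> `|f2 i (t + a, y) - (T i).[a]| <= C1 i * `|a| ^+ K.
  move=> iK.
  apply: (@taylor_bound _ _ (fun j a => f21 i j (t + a, y)) e (C1 i)) => //.
    exact: ltW.
    move=> k x kK xe.
    have := @is_derive_line R _ (f21 i k) (t, y) e1 x.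
    rewrite E1; under [fun x0 => f21 _ _ _]funext => x0 do rewrite E1.
    by apply; exact: class_C_iter_derivable (f2C i iK) kK.
  move=> x xe; have := ebd x 0 xe; rewrite normr0 addr0.
  by move=> /(_ (ltW e0) (Ordinal (iK : (i < K.+1)%N)))[].
have T2 : `|f2 0 (t + a, y + b) -
    (taylor_poly K (fun i b => f2 i (t + a, y + b))).[b]| <= C2 * `|b| ^+ K.
  apply: (@taylor_bound _ _ (fun i b => f2 i (t + a, y + b)) e C2) => //.
    exact: ltW.
    move=> k x kK xe.
    have := @is_derive_line R _ (f2 k) (t + a, y) e2 x.
    rewrite E2; under [fun x0 => f2 _ _]funext => x0 do rewrite E2.
    apply; apply: class_C_iter_derivable (fC) _.
    exact: leq_trans kK (leq_addr _ _).
  by move=> x xe; have /(_ ord0)[] := ebd a x ae xe.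
have -> : F.[b%:P].[a] = \sum_(i < K) (i`!%:R^-1 * (T i).[a]) * b ^+ i.
  rewrite horner_poly horner_sum; apply: eq_bigr => i _.
  by rewrite hornerM hornerZ horner_exp hornerC.
have T3 : (taylor_poly K (fun i b => f2 i (t + a, y + b))).[b] =
    \sum_(i < K) (i`!%:R^-1 * f2 i (t + a, y)) * b ^+ i.
  rewrite horner_poly; apply: eq_bigr => i _.
  by rewrite addr0 [_ / _]mulrC.
set S := \sum_(i < K) _; rewrite T3 in T2.
have T4 : `|\sum_(i < K) (i`!%:R^-1 * f2 i (t + a, y)) * b ^+ i - S| <=
    (\sum_(i < K) C1 i) * `|a| ^+ K.
  rewrite /S -sumrB mulr_suml (le_trans (ler_norm_sum _ _ _)) // ler_sum // => i _.
  rewrite -mulrBl -mulrBr !normrM normrX -mulrA.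
  have b1 : `|b| ^+ i <= 1 by rewrite exprn_ile1 // (le_trans be).
  have i1 : `|i`!%:R^-1 : R| <= 1.
    by rewrite ger0_norm ?invr_ge0 // invf_le1 ?ltr0n ?fact_gt0 // ler1n fact_gt0.
  rewrite -[leRHS]mul1r ler_pM // ?mulr_ge0 ?exprn_ge0 //.
  rewrite -[leRHS]mulr1 ler_pM ?exprn_ge0 //.
  exact: T1 (ltnW (ltn_ord i)).
have := ler_distD (\sum_(i < K) (i`!%:R^-1 * f2 i (t + a, y)) * b ^+ i)
  (f2 0 (t + a, y + b)) S.
move=> /le_trans; apply; rewrite (le_trans (lerD T2 T4)) //.
set D := \sum_(i < K) C1 i; rewrite mulrDr addrC.
have D0 : 0 <= D by rewrite sumr_ge0.
by rewrite lerD // ler_wpM2r ?exprn_ge0 // ?lerDl ?lerDr // addr_ge0.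
Unshelve. all: end_near. Qed.
End Smoothness.

(** * Polynomial solutions modulo a power of t *)

Section Picard.
Variable R : numFieldType.
Implicit Types (p k : {poly R}) (F : {poly {poly R}}).

Definition vanishing_below n p := forall i, (i < n)%N -> p`_i = 0.

Lemma vanishing_belowM n k p : vanishing_below n p -> vanishing_below n (k * p).
Proof.
move=> lp i lt_in; rewrite coefMr big1 // => j _.
by rewrite lp ?mulr0 // (leq_ltn_trans _ lt_in) // -ltnS.
Qed.

Lemma vanishing_below_antideriv n p :
  vanishing_below n p -> vanishing_below n.+1 (antideriv p).
Proof.
move=> lp [|i] lt_in; rewrite coef_antideriv ?invr0 ?mulr0 //=.
by rewrite lp ?mul0r.
Qed.

Lemma vanishing_belowE n p : vanishing_below n p -> p = 'X^n * drop_poly n p.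
Proof.
move=> lp; apply/polyP => i; rewrite coefXnM coef_drop_poly.
by case: ltnP => [/lp//|le_ni]; rewrite subnK.
Qed.

Lemma horner_sub_divides F p q : exists k, F.[p] - F.[q] = k * (p - q).
Proof.
have /factor_theorem[Q QE] : root (F - F.[q]%:P) q.
  by rewrite rootE hornerD hornerN hornerC subrr.
exists Q.[p].
have := congr1 (fun G => G.[p]) QE.
by rewrite hornerM hornerXsubC hornerD hornerN hornerC.
Qed.

Lemma horner_horner F p x : F.[p].[x] = F.[(p.[x])%:P].[x].
Proof.
rewrite !(@horner_coef _ F) !horner_sum; apply: eq_bigr => i _.
by rewrite !hornerM !horner_exp hornerC.
Qed.

(** Picard iteration: consecutive iterates agree to one more order in t at each
    step, since their difference is antidifferentiated twice. *)
Lemma picard_poly F (y0 v0 : R) K : exists P r : {poly R},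
  [/\ P.[0] = y0, P^`().[0] = v0 & P^`(2) - F.[P - y0%:P] = 'X^K * r].
Proof.
pose step p := y0%:P + v0 *: 'X + antideriv (antideriv F.[p - y0%:P]).
(* The iterate K + 1 is needed: its second derivative is computed from the
   iterate K, with which it agrees below degree K. *)
pose P n := iter n step 0.
have PS n : P n.+1 = step (P n) by [].
have step2 p : (step p)^`()^`() = F.[p - y0%:P].
  rewrite /step !derivD derivZ !derivC derivX !antideriv_deriv.
  by rewrite alg_polyC derivC !add0r.
have dP n : vanishing_below n (P n.+1 - P n).
  elim: n => [//|n IHn]; rewrite PS [X in _ - X]PS /step.
  rewrite opprD addrACA subrr add0r -!linearB /=.
  have [k ->] := horner_sub_divides F (P n.+1 - y0%:P) (P n - y0%:P).
  rewrite opprB addrA subrK => i lt_i.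
  have kP := vanishing_belowM k IHn.
  exact: (vanishing_below_antideriv (vanishing_below_antideriv kP) (leqW lt_i)).
have lP : vanishing_below K ((P K.+1)^`(2) - F.[P K.+1 - y0%:P]).
  rewrite /derivn /= -/(P K) -/(step _) step2.
  have [k ->] := horner_sub_divides F (P K - y0%:P) (step (P K) - y0%:P).
  rewrite opprB addrA subrK -PS -opprB mulrN => i lt_i.
  by rewrite coefN (vanishing_belowM k (dP K) lt_i) oppr0.
exists (P K.+1), (drop_poly K ((P K.+1)^`(2) - F.[P K.+1 - y0%:P])).
split; last exact: vanishing_belowE.
  by rewrite PS /step !hornerD antideriv0 hornerZ hornerX hornerC mulr0 !addr0.
rewrite PS /step !derivD derivZ !derivC derivX antideriv_deriv !hornerD antideriv0.
by rewrite horner0 hornerZ hornerC mulr1 add0r addr0.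
Qed.

Lemma horner_bounded p : exists2 M, 0 <= M & forall x, `|x| <= 1 -> `|p.[x]| <= M.
Proof.
exists (\sum_(i < size p) `|p`_i|) => [|x x1]; first by rewrite sumr_ge0.
rewrite horner_coef (le_trans (ler_norm_sum _ _ _)) // ler_sum // => i _.
by rewrite normrM normrX ler_piMr // exprn_ile1.
Qed.

Lemma horner_bounded_root0 p : p.[0] = 0 ->
  exists2 M, 0 <= M & forall x, `|x| <= 1 -> `|p.[x]| <= M * `|x|.
Proof.
move/rootP/factor_theorem => [q ->]; have [M M0 qM] := horner_bounded q.
exists M => // x x1; rewrite hornerM hornerXsubC subr0 normrM.
by rewrite ler_wpM2r // qM.
Qed.

End Picard.

(** * The exact solution and its Taylor polynomial *)

Section ExactSolution.
Variables (R : realType) (f : R * R -> R).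

(** The polynomial [P], which solves the equation of the Taylor polynomial of
    [f], solves the original one on both sides of [t] up to the same order; the
    nodes of the method may lie to the left of [t]. *)
Lemma residual_bound K (F : {poly {poly R}}) (P r : {poly R}) t y0 e C :
  0 < e <= 1 -> 0 <= C ->
  (forall a b, `|a| <= e -> `|b| <= e ->
      `|f (t + a, y0 + b) - F.[b%:P].[a]| <= C * (`|a| ^+ K + `|b| ^+ K)) ->
  P.[0] = y0 -> P^`(2) - F.[P - y0%:P] = 'X^K * r ->
  exists2 e', 0 < e' <= e & exists2 C', 0 <= C' &
    forall a, `|a| <= e' -> `|P^`(2).[a] - f (t + a, P.[a])| <= C' * `|a| ^+ K.
Proof.
move=> /andP[e0 e1] C0 fF P0 PE.
have [M M0 PM] : exists2 M, 0 <= M &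
    forall x, `|x| <= 1 -> `|(P - y0%:P).[x]| <= M * `|x|.
  by apply: horner_bounded_root0; rewrite hornerD hornerN hornerC P0 subrr.
have [Mr Mr0 rM] := horner_bounded r.
have M1 : 0 < M + 1 by rewrite ltr_wpDl.
have e'0 : 0 < e / (M + 1) by rewrite divr_gt0.
have e'e : e / (M + 1) <= e by rewrite ler_pdivrMr // ler_peMr ?lerDr // ltW.
exists (e / (M + 1)); first by rewrite e'0.
exists (Mr + C * (1 + M ^+ K)) => [|a ae].
  by rewrite addr_ge0 // mulr_ge0 // addr_ge0 // exprn_ge0.
have ae1 : `|a| <= e by exact: le_trans e'e.
have a1 : `|a| <= 1 by exact: le_trans e1.
have PyE : (P - y0%:P).[a] = P.[a] - y0 by rewrite hornerD hornerN hornerC.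
have be : `|P.[a] - y0| <= M * `|a| by rewrite -PyE PM.
have be1 : `|P.[a] - y0| <= e.
  apply: le_trans be _; rewrite (@le_trans _ _ ((M + 1) * `|a|)) //.
    by rewrite ler_wpM2r // lerDl.
  by rewrite mulrC -ler_pdivlMr.
have := fF a (P.[a] - y0) ae1 be1; rewrite (addrC y0) subrK => fFa.
have P2E : P^`(2).[a] = a ^+ K * r.[a] + F.[(P.[a] - y0)%:P].[a].
  rewrite -PyE -horner_horner; have := congr1 (fun p => p.[a]) PE.
  by rewrite hornerM hornerXn hornerD hornerN => <-; rewrite subrK.
rewrite P2E -addrA (le_trans (ler_normD _ _)) // mulrDl lerD //.
  by rewrite normrM normrX mulrC ler_wpM2r // ?rM // exprn_ge0.
rewrite distrC (le_trans fFa) // -mulrA ler_wpM2l // mulrDl mul1r lerD2l.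
by rewrite -exprMn lerXn2r ?nnegrE ?mulr_ge0.
Qed.

(** Instead of Gronwall's lemma: each integration of
    |g''| <= L |g| + C x^K improves a bound g = O(x^n) by two orders, until
    n reaches [K]. *)
Lemma exact_solution_bound K (P : {poly R}) (a b : R) y dy t L e C :
  ode2_solution f a b y dy -> a <= t < b -> 0 <= L ->
  (forall x y z, `|f (x, y) - f (x, z)| <= L * `|y - z|) ->
  P.[0] = y t -> P^`().[0] = dy t -> 0 < e -> 0 <= C ->
  (forall x, `|x| <= e -> `|P^`(2).[x] - f (t + x, P.[x])| <= C * `|x| ^+ K) ->
  exists2 e', 0 < e' & exists C', forall x, 0 <= x <= e' ->
    `|y (t + x) - P.[x]| <= C' * x ^+ K /\
    `|dy (t + x) - P^`().[x]| <= C' * x ^+ K.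
Proof.
move=> sol /andP[a_t t_b] L0 fL P0 dP0 e0 C0 PC.
pose g x := y (t + x) - P.[x].
pose dg x := dy (t + x) - P^`().[x].
pose ddg x := f (t + x, y (t + x)) - P^`(2).[x].
have g0 : g 0 = 0 by rewrite /g addr0 P0 subrr.
have dg0 : dg 0 = 0 by rewrite /dg addr0 dP0 subrr.
have : {for t, continuous y}.
  have [|[dyt _] _] := sol t; first by rewrite a_t ltW.
  exact/differentiable_continuous/derivable1_diffP.
move=> /cvgrPdist_le /(_ 1 ltr01) /nbhs_normP[e1 /= e1_gt0 ye1].
have [M M0 PM] := horner_bounded (P - (y t)%:P).
pose e' := Num.min (Num.min e 1) (Num.min (b - t) (e1 / 2)).
have e'0 : 0 < e' by rewrite !lt_min e0 ltr01 subr_gt0 t_b divr_gt0.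
have e'P x : 0 <= x <= e' -> [/\ x <= e, x <= 1, t <= t + x <= b & x < e1].
  rewrite !le_min => /andP[x0 /andP[/andP[xe x1] /andP[xb xe1]]]; split => //; lra.
have gd x : 0 <= x <= e' -> is_derive x (1 : R) g (dg x).
  move=> xe; have [_ _ /andP[x1 x2] _] := e'P x xe.
  have [|yd _] := sol (t + x); first by rewrite x2 (le_trans a_t).
  by apply: is_deriveB_fun (is_derive_poly _ _); exact: is_derive_add_const.
have dgd x : 0 <= x <= e' -> is_derive x (1 : R) dg (ddg x).
  move=> xe; have [_ _ /andP[x1 x2] _] := e'P x xe.
  have [|_ yd] := sol (t + x); first by rewrite x2 (le_trans a_t).
  by apply: is_deriveB_fun (is_derive_poly _ _); exact: is_derive_add_const.
have ddg_le x : 0 <= x <= e' -> `|ddg x| <= L * `|g x| + C * x ^+ K.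
  move=> xe; have [xe0 _ _ _] := e'P x xe; have /andP[x0 _] := xe.
  rewrite /ddg -(subrK (f (t + x, P.[x])) (f (t + x, y (t + x)))) -addrA.
  rewrite (le_trans (ler_normD _ _)) // lerD ?fL //.
  by have := PC x; rewrite ger0_norm // distrC; exact.
have bound n : (n <= K)%N -> exists2 D, 0 <= D & forall x, 0 <= x <= e' ->
   `|g x| <= D * x ^+ n.
  elim: n => [_|n IHn nK].
    exists (M + 1) => [|x xe]; first by rewrite addr_ge0.
    have [_ x1 _ xe1] := e'P x xe; have /andP[x0 _] := xe.
    rewrite expr0 mulr1 /g -(subrK (y t) (y (t + x))) -addrA addrC.
    rewrite (le_trans (ler_normD _ _)) // lerD //.
      have := PM x; rewrite ger0_norm // hornerD hornerN hornerC distrC; exact.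
    by rewrite distrC ye1 //= opprD addNKr normrN ger0_norm.
  have [|D D0 gD] := IHn; first exact: ltnW.
  have LDC : 0 <= L * D + C by rewrite addr_ge0 ?mulr_ge0.
  have ddgD x : 0 <= x <= e' -> `|ddg x| <= (L * D + C) * x ^+ n.
    move=> xe; have [_ x1 _ _] := e'P x xe; have /andP[x0 _] := xe.
    rewrite (le_trans (ddg_le x xe)) // mulrDl -mulrA lerD ?ler_wpM2l ?gD //.
    by apply: ler_wiXn2l => //; exact: ltnW.
  have dgD := integrate_bound LDC dgd dg0 ddgD.
  exists (L * D + C) => // x xe.
  have [_ x1 _ _] := e'P x xe; have /andP[x0 _] := xe.
  apply: le_trans (integrate_bound LDC gd g0 dgD xe) _.
  by rewrite ler_wpM2l // ler_wiXn2l.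
have [//|D D0 gD] := bound K.
have LDC : 0 <= L * D + C by rewrite addr_ge0 ?mulr_ge0.
have ddgD x : 0 <= x <= e' -> `|ddg x| <= (L * D + C) * x ^+ K.
  move=> xe; rewrite (le_trans (ddg_le x xe)) // mulrDl -mulrA lerD2r.
  by rewrite ler_wpM2l ?gD.
have dgD := integrate_bound LDC dgd dg0 ddgD.
exists e' => //; exists (D + (L * D + C)) => x xe.
have [_ x1 _ _] := e'P x xe; have /andP[x0 _] := xe.
have xK := exprn_ge0 K x0.
split; first by rewrite (le_trans (gD x xe)) // ler_wpM2r // lerDl.
apply: le_trans (dgD x xe) _.
apply: (@le_trans _ _ ((L * D + C) * x ^+ K)).
  by rewrite ler_wpM2l // ler_wiXn2l.
by rewrite ler_wpM2r // lerDr.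
Qed.

End ExactSolution.

(** * Stability of the collocation equations *)

Section LinearStability.
Variables (R : realType) (s : nat) (c : 'I_s -> R).
Hypothesis c_inj : injective c.

Definition node_radius : R := 1 + \sum_i `|c i|.
Local Notation rho := node_radius.

Lemma node_radius_ge1 : 1 <= rho.
Proof. by rewrite lerDl sumr_ge0. Qed.

Lemma node_radius_ge0 : 0 <= rho.
Proof. exact: le_trans node_radius_ge1. Qed.

Lemma node_le_radius i : `|c i| <= rho.
Proof.
rewrite /rho (bigD1 i) //= addrCA lerDl addr_ge0 //.
by rewrite sumr_ge0.
Qed.

Lemma node_step_le i h : 0 <= h -> `|c i * h| <= rho * h.
Proof. by move=> h0; rewrite normrM (ger0_norm h0) ler_wpM2r ?node_le_radius. Qed.

Variables (ddw : 'I_s -> R -> R) (e B : R).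
Hypothesis e01 : 0 < e <= 1.
Hypothesis B0 : 0 <= B.
Hypothesis ddw_s : forall k t, `|t| <= e ->
  `|ddw k t - t ^+ k / k`!%:R| <= B * `|t| ^+ s.

(** The coefficient of w_k is weighted by h^k, the size of w_k'' at the
    nodes. *)
Definition wnorm (h : R) (b : 'I_s -> R) := \sum_(k < s) `|h ^+ k * b k|.

Lemma wnorm_ge0 h b : 0 <= wnorm h b. Proof. exact: sumr_ge0. Qed.

Lemma le_wnorm h b (k : 'I_s) : `|h ^+ k * b k| <= wnorm h b.
Proof. by rewrite /wnorm (bigD1 k) //= lerDl sumr_ge0. Qed.

(** After the scaling by h^k, the values at the nodes are those of a polynomial
    of degree less than [s], up to a relative error O(h); the coefficients of
    that polynomial are controlled by Lagrange interpolation. *)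
Lemma linear_stability : exists2 eps, 0 < eps <= 1 & exists2 S, 0 <= S &
  forall h b M, 0 < h <= eps ->
    (forall i, `|\sum_k b k * ddw k (c i * h)| <= M) ->
    wnorm h b <= S * M.
Proof.
have [e0 e1] := andP e01.
pose Lam := \sum_(k < s) \sum_i (k`!%:R * `|(lagrange_poly c i)`_k|).
have Lam0 : 0 <= Lam.
  by apply: sumr_ge0 => k _; apply: sumr_ge0 => i _; rewrite mulr_ge0.
have rho0 : 0 < rho by exact: lt_le_trans node_radius_ge1.
pose A := Lam * (B * rho ^+ s).
have A0 : 0 <= A by rewrite !mulr_ge0 // exprn_ge0 // ltW.
(* The last bound makes A * h at most 1/2, so that the perturbation is
   absorbed. *)
pose eps := Num.min (Num.min 1 (e / rho)) (2 * (A + 1))^-1.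
have A1 : 0 < 2 * (A + 1) by rewrite mulr_gt0 // ltr_wpDl.
exists eps.
  by rewrite !lt_min ltr01 divr_gt0 // invr_gt0 A1 /= !ge_min lexx.
exists (2 * Lam) => [|h b M]; first by rewrite mulr_ge0.
rewrite !le_min => /andP[h0 /andP[/andP[h1 he] hA]] bM.
set G := wnorm h b; have G0 : 0 <= G by exact: wnorm_ge0.
(* The polynomial whose value at c_i is the i-th value at the nodes, when the
   second derivatives of the basis are exactly the t^k / k!. *)
pose p := \poly_(k < s) (if insub k is Some k' then h ^+ k * b k' / k`!%:R else 0).
have pk (k : 'I_s) : p`_k = h ^+ k * b k / k`!%:R.
  by rewrite coef_poly ltn_ord valK.
have ch i : `|c i * h| <= e.
  by rewrite (le_trans (node_step_le _ (ltW h0))) // mulrC -ler_pdivlMr.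
have p_node i : `|p.[c i]| <= M + B * rho ^+ s * (h * G).
  have -> : p.[c i] = \sum_k b k * ddw k (c i * h) -
      \sum_k b k * (ddw k (c i * h) - (c i * h) ^+ k / k`!%:R).
    rewrite -sumrB horner_poly; apply: eq_bigr => k _.
    by rewrite valK exprMn; ring.
  rewrite (le_trans (ler_normB _ _)) // lerD // (le_trans (ler_norm_sum _ _ _)) //.
  rewrite /G /wnorm !mulr_sumr ler_sum // => k _.
  rewrite normrM (le_trans (ler_wpM2l _ (ddw_s _ (ch i)))) //.
  have : `|c i * h| ^+ s <= rho ^+ s * (h * h ^+ k).
    apply: (@le_trans _ _ ((rho * h) ^+ s)).
      by apply: lerXn2r; rewrite ?nnegrE ?node_step_le ?mulr_ge0 ?(ltW h0) ?(ltW rho0).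
    rewrite exprMn ler_wpM2l ?exprn_ge0 ?(ltW rho0) // -exprS.
    by rewrite ler_wiXn2l // ltW.
  move=> /(ler_wpM2l B0) /(ler_wpM2l (normr_ge0 (b k))) /le_trans; apply.
  rewrite normrM ger0_norm ?exprn_ge0 ?(ltW h0) //.
  by rewrite le_eqVlt; apply/orP; left; apply/eqP; ring.
have GE : G <= Lam * (M + B * rho ^+ s * (h * G)).
  rewrite /G /wnorm /Lam mulr_suml ler_sum // => k _.
  have -> : h ^+ k * b k = k`!%:R * p`_k.
    by rewrite pk [RHS]mulrC divfK // pnatr_eq0 -lt0n fact_gt0.
  rewrite {1}(interpolationE c_inj (size_poly _ _ : (size p <= s)%N)) coef_sum.
  rewrite normrM ger0_norm // mulr_suml.
  apply: le_trans (_ : k`!%:R * \sum_i `|(p.[c i] *: lagrange_poly c i)`_k| <= _).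
    by rewrite ler_wpM2l // ler_norm_sum.
  rewrite mulr_sumr ler_sum // => i _.
  by rewrite coefZ normrM -mulrA ler_wpM2l // mulrC ler_wpM2l.
have : Lam * (B * rho ^+ s * (h * G)) <= 2^-1 * G.
  have -> : Lam * (B * rho ^+ s * (h * G)) = (A * h) * G by rewrite /A; ring.
  rewrite ler_wpM2r //.
  have : h * (2 * (A + 1)) <= 1 by rewrite -ler_pdivlMr // mul1r.
  lra.
move: GE; rewrite mulrDr; lra.
Qed.

End LinearStability.

(** Matrices over the reals are known to be a normed module and to be complete;
    the declaration joins the two structures. *)
HB.instance Definition _ (R : realType) m n := NormedModule.on 'M[R]_(m, n).

Section MatrixFacts.

Lemma unitmx_inj (F : fieldType) n (A : 'M[F]_n) :
  (forall b : 'I_n -> F, (forall i, \sum_k b k * A i k = 0) -> forall k, b k = 0) ->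
  A \in unitmx.
Proof.
move=> Ainj; rewrite -unitmx_tr -row_free_unit -kermx_eq0; apply: contraT.
case/rowV0Pn => v /sub_kermxP vA /negP[]; apply/eqP/rowP => k.
rewrite mxE; apply: (Ainj (fun k => v 0 k)) => i.
have := congr1 (fun M : 'rV_n => M 0 i) vA; rewrite !mxE => vA0.
by rewrite -[RHS]vA0; apply: eq_bigr => j _; rewrite mxE.
Qed.

Lemma mx_norm_entry (R : realType) m n (A : 'M[R]_(m, n)) i j : `|A i j| <= `|A|.
Proof.
rewrite [leRHS]/Num.norm /= mx_normrE.
have := @le_bigmax _ R _ 0 (fun x : 'I_m * 'I_n => `|A x.1 x.2|) (i, j).
by [].
Qed.

Lemma mx_norm_le (R : realType) m n (A : 'M[R]_(m, n)) M : 0 <= M ->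
  (forall i j, `|A i j| <= M) -> `|A| <= M.
Proof.
by move=> M0 AM; rewrite [leLHS]/Num.norm /= mx_normrE; apply: bigmax_le.
Qed.

Lemma contraction_fixpoint (R : realType) (V : completeNormedModType R) (g : V -> V) :
  (forall x y, `|g x - g y| <= 2^-1 * `|x - y|) -> exists x, x = g x.
Proof.
move=> g2.
have gfun : set_fun setT setT g by [].
pose gF : {fun [set: V] >-> [set: V]} := HB.pack g (isFun.Build _ _ _ _ g gfun).
have gctr : is_contraction gF.
  have h0 : (0 : R) <= 2^-1 by rewrite invr_ge0.
  exists (NngNum h0); split => /=; first by rewrite invf_lt1 // ltr1n.
  by move=> [x y] /= _; exact: g2.
by have [|x _ xE] := banach_fixed_point gctr closedT; [exists 0 | exists x].
Qed.

End MatrixFacts.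

(** * Collocation with a basis close to the monomials *)

Section Collocation.
Variables (R : realType) (s : nat) (c : 'I_s -> R).
Hypothesis c_inj : injective c.
Local Notation rho := (node_radius c).
Variables (f : R * R -> R) (tn yn dn L : R).
Hypothesis L0 : 0 <= L.
Hypothesis fL : forall x y z, `|f (x, y) - f (x, z)| <= L * `|y - z|.
Variables (w dw ddw : 'I_s -> R -> R) (e B : R).
Hypothesis e01 : 0 < e <= 1.
Hypothesis B0 : 0 <= B.
Hypothesis w_d : forall k t, `|t| <= e -> is_derive t (1 : R) (w k) (dw k t).
Hypothesis dw_d : forall k t, `|t| <= e -> is_derive t (1 : R) (dw k) (ddw k t).
Hypothesis w0 : forall k, w k 0 = 0.
Hypothesis dw0 : forall k, dw k 0 = 0.
Hypothesis ddw_s : forall k t, `|t| <= e ->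
  `|ddw k t - t ^+ k / k`!%:R| <= B * `|t| ^+ s.

Definition coll_fun (b : 'I_s -> R) t := yn + t * dn + \sum_k b k * w k t.
Definition coll_dfun (b : 'I_s -> R) t := dn + \sum_k b k * dw k t.
Definition coll_ddfun (b : 'I_s -> R) t := \sum_k b k * ddw k t.

Definition coll_residual h b i :=
  coll_ddfun b (c i * h) - f (tn + c i * h, coll_fun b (c i * h)).

Definition collocates h b := forall i : 'I_s,
  coll_ddfun b (c i * h) = f (tn + c i * h, coll_fun b (c i * h)).

Lemma is_derive_sum_fun (b : 'I_s -> R) (g dg : 'I_s -> R -> R) t :
  (forall k, is_derive t (1 : R) (g k) (dg k t)) ->
  is_derive t (1 : R) (fun t => \sum_k b k * g k t) (\sum_k b k * dg k t).
Proof.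
move=> gd.
have -> : (fun t => \sum_k b k * g k t) = \sum_(k < s) (b k \*: g k).
  by apply/funext => x; rewrite fct_sumE.
by apply: is_derive_sum => k; exact: is_deriveZ.
Qed.

Lemma is_derive_coll_fun b t : `|t| <= e ->
  is_derive t (1 : R) (coll_fun b) (coll_dfun b t).
Proof.
move=> te; rewrite /coll_fun /coll_dfun.
have -> : (fun t => yn + t * dn + \sum_k b k * w k t) =
    horner (yn%:P + dn *: 'X) + (fun t => \sum_k b k * w k t).
  apply/funext => x; rewrite -[RHS]/((yn%:P + dn *: 'X).[x] + _).
  by rewrite !hornerE (mulrC dn).
apply: is_deriveD.
  apply: is_derive_eq (is_derive_poly _ _) _.
  by rewrite derivD derivC derivZ derivX add0r hornerZ hornerC mulr1.
by apply: is_derive_sum_fun => k; exact: w_d.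
Qed.

Lemma is_derive_coll_dfun b t : `|t| <= e ->
  is_derive t (1 : R) (coll_dfun b) (coll_ddfun b t).
Proof.
move=> te; rewrite -[coll_ddfun b t]add0r; apply: is_deriveD.
by apply: is_derive_sum_fun => k; exact: dw_d.
Qed.

Lemma coll_fun0 b : coll_fun b 0 = yn.
Proof.
by rewrite /coll_fun mul0r addr0 big1 ?addr0 // => k _; rewrite w0 mulr0.
Qed.

Lemma coll_dfun0 b : coll_dfun b 0 = dn.
Proof. by rewrite /coll_dfun big1 ?addr0 // => k _; rewrite dw0 mulr0. Qed.

Lemma w_bound k t : `|t| <= e -> `|w k t| <= (1 + B) * `|t| ^+ k.+2.
Proof.
have B1 : 0 <= 1 + B by rewrite addr_ge0.
have [e0 e1] := andP e01.
apply: (integrate_bound2 B1 (w_d k) (w0 k)).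
apply: (integrate_bound2 B1 (dw_d k) (dw0 k)) => x xe.
rewrite -(subrK (x ^+ k / k`!%:R) (ddw k x)) mulrDl addrC.
rewrite (le_trans (ler_normD _ _)) // lerD //.
  rewrite mul1r normrM normrX ler_piMr ?exprn_ge0 //.
  by rewrite ger0_norm ?invr_ge0 // invf_le1 ?ltr0n ?fact_gt0 // ler1n fact_gt0.
rewrite (le_trans (ddw_s _ xe)) // ler_wpM2l // ler_wiXn2l //.
  exact: le_trans e1.
exact: ltnW.
Qed.

Lemma node_in_range h i : 0 < h <= e / rho -> `|c i * h| <= e.
Proof.
move=> /andP[h0 he].
have rho0 : 0 < rho by exact: lt_le_trans (node_radius_ge1 c).
by rewrite (le_trans (node_step_le _ _ (ltW h0))) // mulrC -ler_pdivlMr.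
Qed.

Lemma e_rho_gt0 : 0 < e / rho.
Proof.
have rho1 := node_radius_ge1 c; have rho0 : 0 < rho by exact: lt_le_trans rho1.
by have [e0 _] := andP e01; rewrite divr_gt0.
Qed.

Lemma e_rho_le1 : e / rho <= 1.
Proof.
have [e0 e1] := andP e01.
have rho1 := node_radius_ge1 c; have rho0 : 0 < rho by exact: lt_le_trans rho1.
by rewrite ler_pdivrMr // mul1r (le_trans e1).
Qed.

Let Cw := (1 + B) * rho ^+ s.+1.

Let Cw0 : 0 <= Cw.
Proof. by rewrite mulr_ge0 ?addr_ge0 // exprn_ge0 // node_radius_ge0. Qed.

Lemma wsum_bound h b i : 0 < h <= e / rho ->
  `|\sum_k b k * w k (c i * h)| <= Cw * h * wnorm h b.
Proof.
move=> hh; have [h0 he] := andP hh; have h1 := le_trans he e_rho_le1.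
rewrite (le_trans (ler_norm_sum _ _ _)) // mulr_sumr ler_sum // => k _.
rewrite normrM (le_trans (ler_wpM2l _ (w_bound _ (node_in_range i hh)))) //.
have B1 : 0 <= 1 + B by rewrite addr_ge0.
have : `|c i * h| ^+ k.+2 <= rho ^+ s.+1 * (h * h ^+ k).
  apply: (@le_trans _ _ ((rho * h) ^+ k.+2)).
    apply: lerXn2r; rewrite ?nnegrE ?node_step_le ?mulr_ge0 ?(ltW h0) //.
    exact: node_radius_ge0.
  rewrite exprMn ler_pM ?exprn_ge0 ?node_radius_ge0 ?(ltW h0) //.
    by apply: ler_weXn2l; [exact: node_radius_ge1 | exact: ltn_ord].
  by rewrite -exprS ler_wiXn2l // ltW.
move=> /(ler_wpM2l B1) /(ler_wpM2l (normr_ge0 (b k))) /le_trans; apply.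
rewrite normrM (ger0_norm (exprn_ge0 _ (ltW h0))).
by rewrite le_eqVlt; apply/orP; left; apply/eqP; rewrite /Cw; ring.
Qed.

Lemma coll_fun_lip h b b' i : 0 < h <= e / rho ->
  `|coll_fun b (c i * h) - coll_fun b' (c i * h)| <=
  Cw * h * wnorm h (fun k => b k - b' k).
Proof.
move=> hh; apply: le_trans (wsum_bound _ i hh).
rewrite /coll_fun opprD addrACA subrr add0r -sumrB.
by under [X in _ <= `|X|]eq_bigr do rewrite mulrBl.
Qed.

(** The unknown function enters the right-hand side through w_k = O(h^2 w_k''),
    so for small h the nonlinear term is absorbed by the linear one.  The last
    clause makes the fixed-point map for the stage values a contraction. *)
Lemma nonlinear_stability : exists2 eps, 0 < eps <= e / rho & exists2 S, 0 <= S &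
  (forall h b M, 0 < h <= eps ->
    (forall i, `|coll_ddfun b (c i * h)| <= M) -> wnorm h b <= S * M) /\
  (forall h b b' M, 0 < h <= eps ->
    (forall i, `|coll_residual h b i - coll_residual h b' i| <= M) ->
    wnorm h (fun k => b k - b' k) <= S * M) /\
  (forall h, 0 < h <= eps -> S * (L * (Cw * h)) <= 2^-1).
Proof.
have [eps0 /andP[e00 e0e] [S0 S00 lin]] := linear_stability c_inj e01 B0 ddw_s.
pose S := 2 * S0; have S_ge0 : 0 <= S by rewrite mulr_ge0.
pose A := S * (L * Cw); have A0 : 0 <= A by exact: mulr_ge0 S_ge0 (mulr_ge0 L0 Cw0).
have A1 : 0 < 2 * (A + 1) by rewrite mulr_gt0 // ltr_wpDl.
pose eps := Num.min (Num.min eps0 (e / rho)) (2 * (A + 1))^-1.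
exists eps.
  by rewrite !lt_min e00 e_rho_gt0 invr_gt0 A1 /= !ge_min lexx orbT.
exists S => //.
have epsP h : 0 < h <= eps ->
    [/\ 0 < h <= eps0, 0 < h <= e / rho & h * (2 * (A + 1)) <= 1].
  rewrite !le_min => /andP[-> /andP[/andP[-> ->] hA]]; split => //.
  by rewrite -ler_pdivlMr // mul1r.
have small h : 0 < h <= eps -> S * (L * (Cw * h)) <= 2^-1.
  move=> /epsP[/andP[h0 _] _ hA].
  have -> : S * (L * (Cw * h)) = A * h by rewrite /A; ring.
  lra.
split; last split => //.
  move=> h b M /epsP[h_eps0 _ _] bM; have := lin h b M h_eps0 bM.
  have M0 : 0 <= wnorm h b by exact: wnorm_ge0.
  rewrite /S; lra.
move=> h b b' M heps bM; have [h_eps0 h_e _] := epsP h heps.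
set G := wnorm _ _.
have G0 : 0 <= G by exact: wnorm_ge0.
have ddM i : `|coll_ddfun (fun k => b k - b' k) (c i * h)| <= M + L * (Cw * h * G).
  have -> : coll_ddfun (fun k => b k - b' k) (c i * h) =
      coll_ddfun b (c i * h) - coll_ddfun b' (c i * h).
    by rewrite /coll_ddfun -sumrB; apply: eq_bigr => k _; rewrite mulrBl.
  have -> : coll_ddfun b (c i * h) - coll_ddfun b' (c i * h) =
     (coll_residual h b i - coll_residual h b' i) +
     (f (tn + c i * h, coll_fun b (c i * h)) - f (tn + c i * h, coll_fun b' (c i * h))).
    by rewrite /coll_residual; ring.
  rewrite (le_trans (ler_normD _ _)) // lerD // (le_trans (fL _ _ _)) //.
  by rewrite ler_wpM2l // coll_fun_lip.
have := lin h _ _ h_eps0 ddM; rewrite -/G.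
have := ler_wpM2r G0 (small h heps).
have -> : S * (L * (Cw * h)) * G = 2 * (S0 * (L * (Cw * h * G))) by rewrite /S; ring.
rewrite mulrDr /S; lra.
Qed.

Definition coll_mx h : 'M[R]_s := \matrix_(i, k) ddw k (c i * h).

Lemma coll_ddfunB h b b' i : coll_ddfun (fun k => b k - b' k) (c i * h) =
  coll_ddfun b (c i * h) - coll_ddfun b' (c i * h).
Proof. by rewrite /coll_ddfun -sumrB; apply: eq_bigr => k _; rewrite mulrBl. Qed.

Lemma wnorm_le0 h (b : 'I_s -> R) : 0 < h -> wnorm h b <= 0 -> forall k, b k = 0.
Proof.
move=> h0 b0 k; have := le_trans (le_wnorm h b k) b0.
by rewrite normr_le0 mulf_eq0 expf_eq0 (gt_eqF h0) andbF /= => /eqP.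
Qed.

Lemma coll_interp h (g : 'I_s -> R) i : coll_mx h \in unitmx ->
  coll_ddfun (fun k => (invmx (coll_mx h) *m \col_j g j) k 0) (c i * h) = g i.
Proof.
move=> Fu; transitivity ((coll_mx h *m (invmx (coll_mx h) *m \col_j g j)) i 0).
  by rewrite [RHS]mxE; apply: eq_bigr => k _; rewrite [coll_mx h i k]mxE mulrC.
by rewrite mulmxA mulmxV // mul1mx mxE.
Qed.

(** The unknown of the fixed-point equation is the vector of the stage values,
    not that of the coefficients: the latter enter only through the norm
    [wnorm], for which the linear part is uniformly invertible. *)
Lemma collocation_exists_unique : exists2 eps, 0 < eps <= e / rho &
  forall h, 0 < h <= eps -> [/\ coll_mx h \in unitmx,
    exists b, collocates h b &
    forall b b', collocates h b -> collocates h b' -> b =1 b'].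
Proof.
have [eps epse [S S0 [lin [nonlin small]]]] := nonlinear_stability.
exists eps => // h heps; have [h0 he] := andP heps.
have hh : 0 < h <= e / rho.
  by have /andP[_ ee] := epse; rewrite h0 (le_trans he).
have Fu : coll_mx h \in unitmx.
  apply: unitmx_inj => b b0; apply: (wnorm_le0 h0); rewrite -(mulr0 S).
  apply: lin => // i; rewrite normr_le0; apply/eqP; rewrite -[RHS](b0 i).
  by apply: eq_bigr => k _; rewrite mxE.
have uniq b b' : collocates h b -> collocates h b' -> b =1 b'.
  move=> cb cb' k; apply/eqP; rewrite -subr_eq0; apply/eqP.
  apply: (@wnorm_le0 h (fun k => b k - b' k)) => //; rewrite -(mulr0 S).
  apply: nonlin => // i.
  by rewrite /coll_residual cb cb' !subrr normr0.
split => //.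
pose beta (Y : 'rV[R]_s) k :=
  (invmx (coll_mx h) *m \col_j f (tn + c j * h, Y 0 j)) k 0.
have betaE Y i : coll_ddfun (beta Y) (c i * h) = f (tn + c i * h, Y 0 i).
  exact: coll_interp.
have [Y YE] : exists Y : 'rV[R]_s, Y = \row_i coll_fun (beta Y) (c i * h).
  apply: (@contraction_fixpoint R 'rV[R]_s) => Y Y'.
  apply: mx_norm_le => [|i j]; first by rewrite mulr_ge0.
  rewrite !mxE (le_trans (coll_fun_lip _ _ _ hh)) //.
  have : wnorm h (fun k => beta Y k - beta Y' k) <= S * (L * `|Y - Y'|).
    apply: lin => // k; rewrite coll_ddfunB !betaE (le_trans (fL _ _ _)) //.
    by rewrite ler_wpM2l //; have := mx_norm_entry (Y - Y') 0 k; rewrite !mxE.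
  have Cwh : 0 <= Cw * h by rewrite mulr_ge0 // ltW.
  move=> /(ler_wpM2l Cwh)/le_trans; apply.
  have -> : Cw * h * (S * (L * `|Y - Y'|)) = S * (L * (Cw * h)) * `|Y - Y'| by ring.
  by rewrite ler_wpM2r // small.
exists (beta Y) => i; rewrite betaE; congr (f (_, _)).
by rewrite [in LHS]YE mxE.
Qed.

Section Bounded.
Variables (P : {poly R}) (K : nat) (C : R).
Hypothesis sK : (s <= K)%N.
Hypothesis P0 : P.[0] = yn.
Hypothesis dP0 : P^`().[0] = dn.
Hypothesis C0 : 0 <= C.
Hypothesis PC : forall x, `|x| <= e ->
  `|P^`(2).[x] - f (tn + x, P.[x])| <= C * `|x| ^+ K.

(** The coefficients of the second derivative of [P] in the functions
    t^k / k!. *)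
Let bstar (k : 'I_s) := k`!%:R * P^`(2)`_k.

Lemma taylor_coll_ddfun : exists2 D, 0 <= D & forall t, `|t| <= e ->
  `|coll_ddfun bstar t - P^`(2).[t]| <= D * `|t| ^+ s.
Proof.
have [e0 e1] := andP e01.
pose q := P^`(2); have [M M0 qM] := horner_bounded (drop_poly s q).
exists (\sum_k `|bstar k| * B + M) => [|t te].
  by rewrite addr_ge0 // sumr_ge0 // => k _; rewrite mulr_ge0.
have -> : P^`(2) = take_poly s q + drop_poly s q * 'X^s by rewrite poly_take_drop.
have -> : coll_ddfun bstar t - (take_poly s q + drop_poly s q * 'X^s).[t] =
    \sum_k bstar k * (ddw k t - t ^+ k / k`!%:R) - (drop_poly s q).[t] * t ^+ s.
  rewrite hornerD hornerM hornerXn opprD addrA; congr (_ - _).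
  rewrite horner_poly -sumrB; apply: eq_bigr => k _.
  rewrite mulrBr; congr (_ - _); rewrite /bstar -/q.
  have nz : k`!%:R != 0 :> R by rewrite pnatr_eq0 -lt0n fact_gt0.
  by field.
rewrite mulrDl (le_trans (ler_normB _ _)) // lerD //.
  rewrite (le_trans (ler_norm_sum _ _ _)) // mulr_suml ler_sum // => k _.
  by rewrite normrM -mulrA ler_wpM2l // ddw_s.
rewrite normrM normrX ler_wpM2r ?exprn_ge0 // qM //.
exact: le_trans e1.
Qed.

(** The coefficients [bstar] satisfy the collocation equations up to O(h^s), so
    by stability the true ones differ from them by O(h^s) in the norm weighted
    by h^k; as k < s, dividing by h^k leaves a bounded difference. *)
Lemma collocation_bounded : exists2 eps, 0 < eps <= e / rho &
  exists2 M, 0 <= M & forall h b, 0 < h <= eps -> collocates h b ->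
    forall k, `|b k| <= M.
Proof.
have [e0 e1] := andP e01.
have [eps epse [S S0 [_ [nonlin _]]]] := nonlinear_stability.
have [D D0 ddD] := taylor_coll_ddfun.
have coll_P t : `|t| <= e -> `|coll_fun bstar t - P.[t]| <= D * `|t| ^+ s.
  move=> te.
  have : `|coll_fun bstar t - P.[t]| <= D * `|t| ^+ s.+2.
    apply: (@integrate_bound2 _ (fun t => coll_fun bstar t - P.[t])
      (fun t => coll_dfun bstar t - P^`().[t]) e) => //.
    - move=> x xe; apply: is_deriveB_fun; first exact: is_derive_coll_fun.
    - by rewrite coll_fun0 P0 subrr.
    apply: (@integrate_bound2 _ (fun t => coll_dfun bstar t - P^`().[t])
      (fun t => coll_ddfun bstar t - P^`(2).[t]) e) => //.
    - move=> x xe; apply: is_deriveB_fun; first exact: is_derive_coll_dfun.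
    - by rewrite coll_dfun0 dP0 subrr.
  move=> /le_trans; apply; rewrite ler_wpM2l // ler_wiXn2l //.
  by rewrite (le_trans te).
  exact: ltnW (leqnSn _).
pose Q := (D + C + L * D) * rho ^+ s.
have DCL : 0 <= D + C + L * D by rewrite !addr_ge0 ?mulr_ge0.
exists eps => //; exists (S * Q + \sum_k `|bstar k|) => [|h b heps cb k].
  by rewrite addr_ge0 ?sumr_ge0 // mulr_ge0 // mulr_ge0 ?exprn_ge0 ?node_radius_ge0.
have [h0 he] := andP heps.
have hh : 0 < h <= e / rho.
  by have /andP[_ ee] := epse; rewrite h0 (le_trans he).
have h1 : h <= 1 by have /andP[_ /le_trans] := hh; apply; exact: e_rho_le1.
have res_star i : `|coll_residual h bstar i| <= Q * h ^+ s.
  have te := node_in_range i hh; set t := c i * h in te *.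
  apply: (@le_trans _ _ ((D + C + L * D) * `|t| ^+ s)); last first.
    rewrite /Q -mulrA ler_wpM2l // -exprMn.
    rewrite lerXn2r ?nnegrE ?mulr_ge0 ?node_radius_ge0 ?(ltW h0) //.
    by rewrite node_step_le // ltW.
  have -> : coll_residual h bstar i = (coll_ddfun bstar t - P^`(2).[t]) +
     (P^`(2).[t] - f (tn + t, P.[t])) +
     (f (tn + t, P.[t]) - f (tn + t, coll_fun bstar t)).
    by rewrite /coll_residual; ring.
  rewrite (le_trans (ler_normD _ _)) // mulrDl lerD //.
    rewrite (le_trans (ler_normD _ _)) // mulrDl lerD //; first exact: ddD.
    rewrite (le_trans (PC te)) // ler_wpM2l // ler_wiXn2l //.
    exact: le_trans e1.
  rewrite (le_trans (fL _ _ _)) // -mulrA ler_wpM2l // distrC.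
  exact: coll_P.
have diff : wnorm h (fun k => b k - bstar k) <= S * (Q * h ^+ s).
  apply: nonlin => // i.
  by rewrite {1}/coll_residual cb subrr sub0r normrN.
have bk : `|b k - bstar k| <= S * Q.
  have := le_trans (le_wnorm _ _ k) diff.
  rewrite normrM ger0_norm ?exprn_ge0 ?(ltW h0) // mulrA => bk.
  have hk : 0 < h ^+ k by exact: exprn_gt0.
  rewrite -(ler_pM2l hk) (le_trans bk) // mulrC ler_wpM2r //.
    by rewrite mulr_ge0 // mulr_ge0 ?exprn_ge0 ?node_radius_ge0.
  by rewrite ler_wiXn2l // ?(ltW h0) // ltnW.
rewrite -(subrK (bstar k) (b k)) (le_trans (ler_normD _ _)) // lerD //.
by rewrite (bigD1 k) //= lerDl sumr_ge0.
Qed.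

End Bounded.

End Collocation.

(** * Order of collocation at orthogonal nodes *)

Section CollocationOrder.
Variables (R : realType) (s q : nat) (c : 'I_s -> R).
Hypothesis c_inj : injective c.
Hypothesis orth : forall j, (j < q)%N -> moment j (node_poly c) 1 = 0.
Local Notation rho := (node_radius c).
Local Notation m := (s + q).+1.
Variables (f : R * R -> R) (tn yn dn L : R).
Hypothesis L0 : 0 <= L.
Hypothesis fL : forall x y z, `|f (x, y) - f (x, z)| <= L * `|y - z|.
Variables (w dw ddw : 'I_s -> R -> R) (e B : R).
Hypothesis e01 : 0 < e <= 1.
Hypothesis B0 : 0 <= B.
Hypothesis w_d : forall k t, `|t| <= e -> is_derive t (1 : R) (w k) (dw k t).
Hypothesis dw_d : forall k t, `|t| <= e -> is_derive t (1 : R) (dw k) (ddw k t).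
Hypothesis w0 : forall k, w k 0 = 0.
Hypothesis dw0 : forall k, dw k 0 = 0.
Hypothesis ddw_s : forall k t, `|t| <= e ->
  `|ddw k t - t ^+ k / k`!%:R| <= B * `|t| ^+ s.
Variable om : 'I_s -> {poly R}.
Hypothesis ddw_m : forall k t, `|t| <= e ->
  `|ddw k t - (om k).[t]| <= B * `|t| ^+ m.
Variables (F : {poly {poly R}}) (P r : {poly R}) (C : R).
Hypothesis C0 : 0 <= C.
Hypothesis fF : forall a b, `|a| <= e -> `|b| <= e ->
  `|f (tn + a, yn + b) - F.[b%:P].[a]| <= C * (`|a| ^+ m + `|b| ^+ m).
Hypothesis P0 : P.[0] = yn.
Hypothesis dP0 : P^`().[0] = dn.
Hypothesis PE : P^`(2) - F.[P - yn%:P] = 'X^m * r.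
Hypothesis PC : forall x, `|x| <= e ->
  `|P^`(2).[x] - f (tn + x, P.[x])| <= C * `|x| ^+ m.

Let Om k := antideriv (antideriv (om k)).
Let U (b : 'I_s -> R) := yn%:P + dn *: 'X + \sum_k b k *: Om k.

Let UE b t : (U b).[t] = yn + t * dn + \sum_k b k * (Om k).[t].
Proof.
rewrite /U !hornerD hornerC hornerZ hornerX horner_sum mulrC.
by under eq_bigr do rewrite hornerZ.
Qed.

Let dUE b t : (U b)^`().[t] = dn + \sum_k b k * (antideriv (om k)).[t].
Proof.
rewrite /U !derivD derivC derivZ derivX add0r hornerD hornerZ hornerC mulr1.
rewrite linear_sum /= horner_sum; congr (_ + _); apply: eq_bigr => k _.
by rewrite derivZ hornerZ antideriv_deriv.
Qed.

Let ddUE b t : (U b)^`(2).[t] = \sum_k b k * (om k).[t].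
Proof.
rewrite /derivn /= /U !derivD derivC linear0 derivZ derivX add0r alg_polyC derivC add0r.
rewrite linear_sum /= linear_sum /= horner_sum; apply: eq_bigr => k _.
by rewrite !derivZ hornerZ !antideriv_deriv.
Qed.

Let w_m k t : `|t| <= e -> `|w k t - (Om k).[t]| <= B * `|t| ^+ m.+2.
Proof.
apply: (@integrate_bound2 _ (fun t => w k t - (Om k).[t])
  (fun t => dw k t - (antideriv (om k)).[t]) e) => //.
- move=> x xe; apply: is_deriveB_fun; first exact: w_d.
  by apply: is_derive_eq; rewrite antideriv_deriv.
- by rewrite w0 antideriv0 subrr.
apply: (@integrate_bound2 _ (fun t => dw k t - (antideriv (om k)).[t])
  (fun t => ddw k t - (om k).[t]) e) => //.
- move=> x xe; apply: is_deriveB_fun; first exact: dw_d.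
  by apply: is_derive_eq; rewrite antideriv_deriv.
- by rewrite dw0 antideriv0 subrr.
by move=> x xe; exact: ddw_m.
Qed.

Let dw_m k t : `|t| <= e -> `|dw k t - (antideriv (om k)).[t]| <= B * `|t| ^+ m.+1.
Proof.
apply: (@integrate_bound2 _ (fun t => dw k t - (antideriv (om k)).[t])
  (fun t => ddw k t - (om k).[t]) e) => //.
- move=> x xe; apply: is_deriveB_fun; first exact: dw_d.
  by apply: is_derive_eq; rewrite antideriv_deriv.
- by rewrite dw0 antideriv0 subrr.
by move=> x xe; exact: ddw_m.
Qed.

Let sum_bound (b : 'I_s -> R) (g g' : 'I_s -> R) M D :
  0 <= D -> (forall k, `|b k| <= M) -> (forall k, `|g k - g' k| <= D) ->
  `|\sum_k b k * g k - \sum_k b k * g' k| <= s%:R * M * D.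
Proof.
move=> D0 bM gD; rewrite -sumrB (le_trans (ler_norm_sum _ _ _)) //.
rewrite (@le_trans _ _ (\sum_(k < s) M * D)) ?ler_sum // => [k _|].
  by rewrite -mulrBr normrM ler_pM.
by rewrite sumr_const card_ord -[_ *+ s]mulr_natl mulrA.
Qed.

(** Only the transfer to polynomials is left.  The functions [w k] are replaced
    by the polynomials [Om k], which changes the values at the nodes by O(h^m)
    because the coefficients are bounded, and the family of all the solutions
    of the collocation equations for small steps is fed to
    [superconvergence]. *)
Theorem collocation_order : exists2 eps, 0 < eps <= e / rho & exists C', forall h b,
  0 < h <= eps -> collocates c f tn yn dn w ddw h b ->
  `|P.[h] - coll_fun yn dn w b h| <= C' * h ^+ m /\
  `|P^`().[h] - coll_dfun dn dw b h| <= C' * h ^+ m.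
Proof.
have [e0 e1] := andP e01.
have sm : (s <= m)%N by rewrite leqW ?leq_addr.
have [eps0 epse [M M0 bM]] := collocation_bounded c_inj L0 fL e01 B0
  w_d dw_d w0 dw0 ddw_s sm P0 dP0 C0 PC.
have [MO MO0 OmM] : exists2 MO : 'I_s -> R, (forall k, 0 <= MO k) &
    forall k t, `|t| <= 1 -> `|(Om k).[t]| <= MO k * `|t|.
  apply: (@fin_all_exists2 _ _ (fun k x => 0 <= x)
    (fun k x => forall t, `|t| <= 1 -> `|(Om k).[t]| <= x * `|t|)) => k.
  by apply: horner_bounded_root0; exact: antideriv0.
pose MU := `|dn| + \sum_k M * MO k.
have MU0 : 0 <= MU by rewrite addr_ge0 // sumr_ge0 // => k _; rewrite mulr_ge0.
have rho1 := node_radius_ge1 c; have rho0 : 0 < rho by exact: lt_le_trans rho1.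
have MUr : 0 < (MU + 1) * rho by rewrite mulr_gt0 // ltr_wpDl.
have [eps00 eps0e] := andP epse.
(* The second bound keeps U - yn in the range of the Taylor expansion of f at
   all the nodes. *)
pose eps := Num.min eps0 (e / ((MU + 1) * rho)).
have eps_gt0 : 0 < eps by rewrite lt_min eps00 divr_gt0.
exists eps; first by rewrite eps_gt0 ge_min eps0e.
pose I := {x : R * ('I_s -> R) |
  0 < x.1 <= eps /\ collocates c f tn yn dn w ddw x.1 x.2}.
pose h (x : I) := (sval x).1; pose bx (x : I) := (sval x).2.
have hP x : [/\ 0 < h x, h x <= eps0 & (MU + 1) * rho * h x <= e].
  have [/andP[hx0 +] _] := svalP x; rewrite /h le_min ler_pdivlMr // mulrC.
  by move=> /andP[].
have h0 x : 0 < h x by case: (hP x).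
have h_in x : 0 < h x <= e / rho.
  by case: (hP x) => -> /= h1 _; exact: le_trans eps0e.
have h1 x : h x <= 1.
  by have /andP[_ /le_trans] := h_in x; apply; exact: e_rho_le1.
have b_bd x k : `|bx x k| <= M.
  have [_ cb] := svalP x; have [hx0 he _] := hP x.
  by apply: (bM (h x)) => //; rewrite hx0.
have cx x : collocates c f tn yn dn w ddw (h x) (bx x) by have [] := svalP x.
have U_w b t : (forall k, `|b k| <= M) -> `|t| <= e ->
    `|coll_fun yn dn w b t - (U b).[t]| <= s%:R * M * B * `|t| ^+ m.
  move=> bd te; rewrite /coll_fun UE opprD addrACA subrr add0r -mulrA.
  apply: sum_bound => // [|k]; first by rewrite mulr_ge0 // exprn_ge0.
  rewrite (le_trans (w_m k te)) // ler_wpM2l // ler_wiXn2l //.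
    exact: le_trans te e1.
  exact: leqW (leqnSn _).
have dU_w b t : (forall k, `|b k| <= M) -> `|t| <= e ->
    `|coll_dfun dn dw b t - (U b)^`().[t]| <= s%:R * M * B * `|t| ^+ m.
  move=> bd te; rewrite /coll_dfun dUE opprD addrACA subrr add0r -mulrA.
  apply: sum_bound => // [|k]; first by rewrite mulr_ge0 // exprn_ge0.
  rewrite (le_trans (dw_m k te)) // ler_wpM2l // ler_wiXn2l //.
  exact: le_trans te e1.
have ddU_w b t : (forall k, `|b k| <= M) -> `|t| <= e ->
    `|coll_ddfun ddw b t - (U b)^`(2).[t]| <= s%:R * M * B * `|t| ^+ m.
  move=> bd te; rewrite /coll_ddfun ddUE -mulrA.
  apply: sum_bound => // [|k]; first by rewrite mulr_ge0 // exprn_ge0.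
  exact: ddw_m.
have U_y b t : (forall k, `|b k| <= M) -> `|t| <= 1 -> `|(U b).[t] - yn| <= MU * `|t|.
  move=> bd t1; rewrite UE -[yn + _ + _]addrA [yn + _]addrC addrK.
  rewrite mulrDl (le_trans (ler_normD _ _)) //.
  apply: lerD; first by rewrite normrM mulrC.
  rewrite (le_trans (ler_norm_sum _ _ _)) //.
  rewrite mulr_suml ler_sum // => k _.
  by rewrite normrM -mulrA ler_pM // OmM.
have := @superconvergence _ s q c c_inj orth I h h0 h1 yn F P r (fun x => U (bx x)) PE.
case.
- apply: bounded_familyD; first exact: bounded_family_cst.
  apply: bounded_family_sum => k; apply: bounded_familyZ (bounded_family_cst _ _).
  by exists M => x; rewrite expr0 mulr1.
- move=> x; rewrite UE mul0r addr0 P0 big1 ?addr0 // => k _.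
  by rewrite antideriv0 mulr0.
- by move=> x; rewrite dUE dP0 big1 ?addr0 // => k _; rewrite antideriv0 mulr0.
- move=> i; apply: (@unifO_le _ _ h h0 h1 m); first exact: leqnSn.
  pose D := s%:R * M * B + L * (s%:R * M * B) + C * (1 + MU ^+ m).
  exists (D * rho ^+ m) => x.
  have te := node_in_range i (h_in x); set t := c i * h x in te *.
  have t1 := le_trans te e1.
  have bd := b_bd x; set b := bx x in bd *.
  have Dt : D * `|t| ^+ m <= D * rho ^+ m * h x ^+ m.
    rewrite -mulrA -exprMn ler_wpM2l //.
      by rewrite !addr_ge0 ?mulr_ge0 ?addr_ge0 ?exprn_ge0.
    apply: lerXn2r; rewrite ?nnegrE ?mulr_ge0 ?(ltW rho0) ?(ltW (h0 x)) //.
    by rewrite node_step_le // ltW.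
  apply: le_trans Dt.
  have Uy : `|(U b).[t] - yn| <= MU * `|t| by exact: U_y.
  have Uye : `|(U b).[t] - yn| <= e.
    apply: le_trans Uy _; case: (hP x) => hx0 _; apply: le_trans.
    rewrite -mulrA ler_pM ?lerDl //.
    by rewrite node_step_le // ltW.
  have Ff : `|f (tn + t, (U b).[t]) - F.[U b - yn%:P].[t]| <=
      C * (1 + MU ^+ m) * `|t| ^+ m.
    rewrite horner_horner [(U b - _).[t]]hornerD hornerN hornerC.
    have := fF te Uye; rewrite [yn + _]addrC subrK => /le_trans; apply.
    rewrite -mulrA ler_wpM2l // mulrDl mul1r lerD2l -exprMn.
    by rewrite lerXn2r ?nnegrE ?mulr_ge0.
  have -> : ((U b)^`(2) - F.[U b - yn%:P]).[t] =
      - (coll_ddfun ddw b t - (U b)^`(2).[t]) +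
      (f (tn + t, coll_fun yn dn w b t) - f (tn + t, (U b).[t])) +
      (f (tn + t, (U b).[t]) - F.[U b - yn%:P].[t]).
    rewrite [LHS]hornerD hornerN.
    by have := cx x i; rewrite -/t -/b => ->; ring.
  rewrite (le_trans (ler_normD _ _)) // /D mulrDl lerD //.
  rewrite (le_trans (ler_normD _ _)) // mulrDl lerD //.
    by rewrite normrN ddU_w.
  by rewrite (le_trans (fL _ _ _)) // -[L * _ * _]mulrA ler_wpM2l // U_w.
move=> [C1 C1P] [C2 C2P].
exists (`|C1| + `|C2| + s%:R * M * B) => h' b' h'e cb.
pose x : I := exist _ (h', b') (conj h'e cb).
have h'0 : 0 < h' := h0 x.
have h'm : 0 <= h' ^+ m by rewrite exprn_ge0 // ltW.
have h'_e : `|h'| <= e.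
  rewrite gtr0_norm //; have /andP[_ /le_trans] := h_in x; apply.
  by rewrite ler_pdivrMr // ler_peMr // ltW.
split.
  have := U_w b' h' (b_bd x) h'_e; have := C1P x; rewrite /h /bx /=.
  rewrite hornerD hornerN (gtr0_norm h'0) => PU UW.
  rewrite -(subrK (U b').[h'] P.[h']) -addrA (le_trans (ler_normD _ _)) //.
  rewrite mulrDl lerD //; last by rewrite distrC.
  rewrite (le_trans PU) // ler_wpM2r // (le_trans (ler_norm _)) //.
  by rewrite lerDl.
have := dU_w b' h' (b_bd x) h'_e; have := C2P x; rewrite /h /bx /=.
rewrite derivB hornerD hornerN (gtr0_norm h'0) => PU UW.
rewrite -(subrK (U b')^`().[h'] P^`().[h']) -addrA (le_trans (ler_normD _ _)) //.
rewrite mulrDl lerD //; last by rewrite distrC.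
rewrite (le_trans PU) // ler_wpM2r // (le_trans (ler_norm _)) //.
by rewrite lerDr.
Qed.

End CollocationOrder.

(** * From the fitted method to collocation *)

Lemma Rintegral_poly (R : realType) (p : {poly R}) :
  \int[@lebesgue_measure R]_(x in `[0, 1]) p.[x] = (antideriv p).[1].
Proof.
have cts (r : {poly R}) : continuous (horner r).
  by move=> x; apply/differentiable_continuous/derivable1_diffP/derivable_horner.
rewrite /Rintegral (@continuous_FTC2 _ _ (horner (antideriv p))) //.
- by rewrite antideriv0 sube0.
- exact/continuous_subspaceT/cts.
- split.
  + by move=> x _; exact: derivable_horner.
  + by apply: cvg_at_right_filter; exact: cts.
  + by apply: cvg_at_left_filter; exact: cts.
- by move=> x _; rewrite -derivE antideriv_deriv.
Qed.

Section BasisChange.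
Variables (R : realType) (s : nat) (c : 'I_s -> R) (u : 'I_s -> R -> R) (tn : R).
Local Notation W := (wronskian2_mx u tn).
Hypothesis Wu : W \in unitmx.

(** The functions w_k; [wbasis1] are their first derivatives, and [wbasisn n]
    their derivatives of order n for n >= 2, to which the subtracted
    first-order parts do not contribute. *)
Definition wbasis (k : 'I_s) t := \sum_l invmx W l k *
  (u l (tn + t) - u l tn - t * derive1 (u l) tn).
Definition wbasis1 (k : 'I_s) t := \sum_l invmx W l k *
  (derive1 (u l) (tn + t) - derive1 (u l) tn).
Definition wbasisn n (k : 'I_s) t := \sum_l invmx W l k * derive1n n (u l) (tn + t).

(** What holds for all the w_k holds for all the u_k. *)
Lemma invmx_inj_sum (g g' : 'I_s -> R) :
  (forall k, \sum_l invmx W l k * g l = \sum_l invmx W l k * g' l) -> g =1 g'.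
Proof.
move=> gg' l; have gW (g0 : 'I_s -> R) :
    g0 l = ((\row_k \sum_l0 invmx W l0 k * g0 l0) *m W) 0 l.
  have -> : (\row_k \sum_l0 invmx W l0 k * g0 l0) = (\row_l0 g0 l0) *m invmx W.
    by apply/rowP => k; rewrite !mxE; apply: eq_bigr => j _; rewrite mxE mulrC.
  by rewrite mulmxKV // mxE.
rewrite (gW g) (gW g'); congr ((_ *m _) _ _).
by apply/rowP => k; rewrite !mxE.
Qed.

Lemma wbasis0 k : wbasis k 0 = 0.
Proof.
by rewrite /wbasis big1 // => l _; rewrite addr0 subrr mul0r subr0 mulr0.
Qed.

Lemma wbasis10 k : wbasis1 k 0 = 0.
Proof. by rewrite /wbasis1 big1 // => l _; rewrite addr0 subrr mulr0. Qed.

Lemma wbasisn_wronskian (j k : 'I_s) : wbasisn j.+2 k 0 = (j == k)%:R.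
Proof.
have := congr1 (fun M : 'M[R]_s => M j k) (mulmxV Wu); rewrite !mxE => <-.
by apply: eq_bigr => l _; rewrite [W j l]mxE addr0 mulrC.
Qed.

(** The defining relations of the coefficients of the method, written for the
    functions w_k. *)
Definition coeffs_wbasis h (A : 'M[R]_s) (b d : 'I_s -> R) := forall k : 'I_s,
  [/\ wbasis k h = h ^+ 2 * \sum_i b i * wbasisn 2 k (c i * h),
      wbasis1 k h = h * \sum_i d i * wbasisn 2 k (c i * h)
    & forall i, wbasis k (c i * h) =
        h ^+ 2 * \sum_j A i j * wbasisn 2 k (c j * h)].

Lemma wbasisn_sum a (b : 'I_s -> R) k h :
  a * \sum_i b i * wbasisn 2 k (c i * h) =
  \sum_l invmx W l k * (a * \sum_i b i * derive1n 2 (u l) (tn + c i * h)).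
Proof.
transitivity (\sum_i \sum_l
    a * (b i * (invmx W l k * derive1n 2 (u l) (tn + c i * h)))).
  by rewrite mulr_sumr; apply: eq_bigr => i _; rewrite /wbasisn !mulr_sumr.
rewrite exchange_big; apply: eq_bigr => l _; rewrite !mulr_sumr.
by apply: eq_bigr => i _; ring.
Qed.

Lemma frkn_coeffsE h A b d :
  frkn_coeffs c u tn h A b d <-> coeffs_wbasis h A b d.
Proof.
split=> [coef k|coef].
  split=> [||i]; rewrite wbasisn_sum; apply: eq_bigr => l _; congr (_ * _);
    have [e1 e2 e3] := coef l.
  - by rewrite e1; ring.
  - by rewrite e2; ring.
  - by rewrite e3; ring.
have h1 : (fun l => u l (tn + h) - u l tn - h * derive1 (u l) tn) =1
    (fun l => h ^+ 2 * \sum_i b i * derive1n 2 (u l) (tn + c i * h)).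
  apply: invmx_inj_sum => k; rewrite -wbasisn_sum.
  by have [<- _ _] := coef k.
have h2 : (fun l => derive1 (u l) (tn + h) - derive1 (u l) tn) =1
    (fun l => h * \sum_i d i * derive1n 2 (u l) (tn + c i * h)).
  apply: invmx_inj_sum => k; rewrite -wbasisn_sum.
  by have [_ <- _] := coef k.
have h3 i : (fun l => u l (tn + c i * h) - u l tn - c i * h * derive1 (u l) tn) =1
    (fun l => h ^+ 2 * \sum_j A i j * derive1n 2 (u l) (tn + c j * h)).
  apply: invmx_inj_sum => k; rewrite -wbasisn_sum.
  by have [_ _ <-] := coef k.
move=> k; split=> [||i].
- by rewrite -h1; ring.
- by rewrite -h2; ring.
- by rewrite -h3; ring.
Qed.

Variables (f : R * R -> R) (yn dn : R).
Local Notation collocates h b := (collocates c f tn yn dn wbasis (wbasisn 2) h b).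
Local Notation coll_mx h := (coll_mx c (wbasisn 2) h).

Lemma coll_mx_solve h (g : 'I_s -> R) : coll_mx h \in unitmx ->
  exists b, forall k, \sum_i b i * wbasisn 2 k (c i * h) = g k.
Proof.
move=> Fu; exists (fun i => ((\row_k g k) *m invmx (coll_mx h)) 0 i) => k.
transitivity (((\row_k g k) *m invmx (coll_mx h) *m coll_mx h) 0 k).
  by rewrite [RHS]mxE; apply: eq_bigr => i _; rewrite [coll_mx h i k]mxE.
by rewrite mulmxKV // mxE.
Qed.

Lemma exists_coeffs h : 0 < h -> coll_mx h \in unitmx ->
  exists A b d, coeffs_wbasis h A b d.
Proof.
move=> h0 Fu; have hn0 : h != 0 by rewrite gt_eqF.
have [b bE] := coll_mx_solve (fun k => wbasis k h / h ^+ 2) Fu.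
have [d dE] := coll_mx_solve (fun k => wbasis1 k h / h) Fu.
have /choice[A AE] i := coll_mx_solve (fun k => wbasis k (c i * h) / h ^+ 2) Fu.
exists (\matrix_(i, j) A i j), b, d => k; split=> [||i].
- by rewrite bE [RHS]mulrC divfK // expf_neq0.
- by rewrite dE [RHS]mulrC divfK.
under eq_bigr do rewrite mxE.
by rewrite AE [RHS]mulrC divfK // expf_neq0.
Qed.

Lemma sum_ddfun (be b : 'I_s -> R) (g : 'I_s -> R) a h :
  (forall k, g k = a * \sum_i b i * wbasisn 2 k (c i * h)) ->
  a * \sum_i b i * coll_ddfun (wbasisn 2) be (c i * h) = \sum_k be k * g k.
Proof.
move=> gE; under [RHS]eq_bigr do rewrite gE mulrCA mulr_sumr.
rewrite -mulr_sumr exchange_big; congr (_ * _); apply: eq_bigr => i _.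
by rewrite mulr_sumr; apply: eq_bigr => k _; rewrite mulrCA.
Qed.

(** If b interpolates the stage values of f by w_k'', the exactness relations
    turn the sums weighted by the coefficients of the method into sums of the
    b_k w_k, so that the stages become values of the collocation function. *)
Lemma frkn_stepE h z : 0 < h -> coll_mx h \in unitmx ->
  frkn_step c u f tn yn dn h z <->
  exists be, [/\ collocates h be, z.1 = coll_fun yn dn wbasis be h &
    z.2 = coll_dfun dn wbasis1 be h].
Proof.
move=> h0 Fu; split.
  move=> [A [b [d [Y [/frkn_coeffsE coef YE z1 z2]]]]].
  pose be k := (invmx (coll_mx h) *m \col_j f (tn + c j * h, Y j)) k 0.
  have beE i : coll_ddfun (wbasisn 2) be (c i * h) = f (tn + c i * h, Y i).
    exact: (@coll_interp _ _ c (wbasisn 2) h (fun j => f (tn + c j * h, Y j))).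
  have YU i : Y i = coll_fun yn dn wbasis be (c i * h).
    rewrite YE /coll_fun; congr (_ + _).
    under eq_bigr do rewrite -beE.
    by apply: sum_ddfun => k; have [] := coef k.
  exists be; split.
  - by move=> i; rewrite beE YU.
  - rewrite z1 /coll_fun; congr (_ + _).
    under eq_bigr do rewrite -beE.
    by apply: sum_ddfun => k; have [] := coef k.
  rewrite z2 /coll_dfun; congr (_ + _).
  under eq_bigr do rewrite -beE.
  by apply: sum_ddfun => k; have [] := coef k.
move=> [be [col z1 z2]].
have [A [b [d coef]]] := exists_coeffs h0 Fu.
exists A, b, d, (fun i => coll_fun yn dn wbasis be (c i * h)); split.
- exact/frkn_coeffsE.
- move=> i; rewrite [LHS]/coll_fun; congr (_ + _).
  under [in RHS]eq_bigr do rewrite -col.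
  by apply/esym/sum_ddfun => k; have [] := coef k.
- rewrite z1 /coll_fun; congr (_ + _).
  under [in RHS]eq_bigr do rewrite -col.
  by apply/esym/sum_ddfun => k; have [] := coef k.
rewrite z2 /coll_dfun; congr (_ + _).
under [in RHS]eq_bigr do rewrite -col.
by apply/esym/sum_ddfun => k; have [] := coef k.
Qed.

Variable N : nat.
Hypothesis uC : forall k, class_C N (u k).

Lemma is_derive_wbasisn n k t : (n < N)%N ->
  is_derive t (1 : R) (wbasisn n k) (wbasisn n.+1 k t).
Proof.
move=> nN; apply: (@is_derive_sum_fun _ _ _ (fun l t => derive1n n (u l) (tn + t))
  (fun l t => derive1n n.+1 (u l) (tn + t))) => l.
by apply: is_derive_add_const; exact: class_C_is_derive1n nN.
Qed.

Lemma is_derive_wbasis1 k t : (1 < N)%N ->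
  is_derive t (1 : R) (wbasis1 k) (wbasisn 2 k t).
Proof.
move=> nN; apply: (@is_derive_sum_fun _ _ _
  (fun l t => derive1 (u l) (tn + t) - derive1 (u l) tn)
  (fun l t => derive1n 2 (u l) (tn + t))) => l.
rewrite -[X in is_derive _ _ _ X]subr0; apply: is_deriveB_fun.
by apply: is_derive_add_const; exact: (class_C_is_derive1n _ (uC l) nN).
Qed.

Lemma is_derive_wbasis k t : (0 < N)%N ->
  is_derive t (1 : R) (wbasis k) (wbasis1 k t).
Proof.
move=> nN; apply: (@is_derive_sum_fun _ _ _
  (fun l t => u l (tn + t) - u l tn - t * derive1 (u l) tn)
  (fun l t => derive1 (u l) (tn + t) - derive1 (u l) tn)) => l.
apply: is_deriveB_fun; last first.
  have -> : (fun x : R => x * derive1 (u l) tn) = horner (derive1 (u l) tn *: 'X).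
    by apply/funext => x; rewrite !hornerE mulrC.
  apply: is_derive_eq (is_derive_poly _ _) _.
  by rewrite derivZ derivX hornerZ hornerC mulr1.
rewrite -[X in is_derive _ _ _ X]subr0; apply: is_deriveB_fun.
by apply: is_derive_add_const; exact: (class_C_is_derive1n _ (uC l) nN).
Qed.

Lemma continuous_wbasisn n k : (n <= N)%N -> {for 0, continuous (wbasisn n k)}.
Proof.
move=> nN; apply: (@cvg_big _ _ +%R 0) => [|l _]; first exact: add_continuous.
apply: cvgMr.
have /(_ (tn + 0)) cu := class_C_derive1n_continuous (uC l) nN.
have ctn : {for 0, continuous (fun t : R => tn + t)}.
  by apply: cvgD; [exact: cvg_cst | exact: cvg_id].
have cc := @continuous_comp R R R (fun t => tn + t) (derive1n n (u l)) 0 ctn cu.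
exact: cc.
Qed.

(** The choice of the w_k makes their Taylor coefficients of order k + 2 equal to
    the entries of the identity matrix, whence the leading term t^k / k!. *)
Lemma wbasis_taylor m : (s <= m)%N -> (m.+2 <= N)%N ->
  exists2 e, 0 < e <= 1 & exists2 B, 0 <= B &
  exists om : 'I_s -> {poly R}, forall k t, `|t| <= e ->
    `|wbasisn 2 k t - t ^+ k / k`!%:R| <= B * `|t| ^+ s /\
    `|wbasisn 2 k t - (om k).[t]| <= B * `|t| ^+ m.
Proof.
move=> sm mN.
pose G k j t := wbasisn j.+2 k t.
have : \forall t \near (0 : R), forall k : 'I_s,
    `|G k s t| <= `|G k s 0| + 1 /\ `|G k m t| <= `|G k m 0| + 1.
  apply: (@filter_forall _ _ (fun (k : 'I_s) (t : R) => `|G k s t| <= `|G k s 0| + 1 /\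
    `|G k m t| <= `|G k m 0| + 1) (nbhs (0 : R)) _) => k.
  have As : \forall t \near (0 : R), `|G k s t| <= `|G k s 0| + 1.
    apply: continuous_locally_bounded; apply: continuous_wbasisn.
    by rewrite (leq_trans _ mN) // !ltnS.
  have Am : \forall t \near (0 : R), `|G k m t| <= `|G k m 0| + 1.
    by apply: continuous_locally_bounded; apply: continuous_wbasisn.
  by apply: filterS2 As Am => t.
move=> /nbhs_normP[e0 /= e00 bd].
pose e := Num.min (e0 / 2) 1.
have e_gt0 : 0 < e by rewrite lt_min ltr01 divr_gt0.
have bde t : `|t| <= e -> forall k, `|G k s t| <= `|G k s 0| + 1 /\
    `|G k m t| <= `|G k m 0| + 1.
  move=> te; apply: bd => /=; rewrite sub0r normrN.
  by rewrite (le_lt_trans te) // gt_min ltr_pdivrMr // ltr_pMr // ltr1n.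
exists e; first by rewrite e_gt0 ge_min lexx orbT.
pose Bk k := (`|G k s 0| + 1) + (`|G k m 0| + 1).
have Bk0 k : 0 <= Bk k by rewrite !addr_ge0.
have BB k : Bk k <= \sum_k Bk k.
  by rewrite [leRHS](bigD1 k) //= lerDl sumr_ge0.
exists (\sum_k Bk k); first by rewrite sumr_ge0.
exists (fun k => taylor_poly m (G k)) => k t te.
have Gd n : (n <= m)%N -> forall j t, (j < n)%N -> `|t| <= e ->
    is_derive t (1 : R) (G k j) (G k j.+1 t).
  move=> nm j x jn _; apply: is_derive_wbasisn.
  by rewrite (leq_trans _ mN) // !ltnS (leq_trans jn).
have Gs x : `|x| <= e -> `|G k s x| <= \sum_k Bk k.
  move=> xe; have [+ _] := bde x xe k => /le_trans; apply.
  by rewrite (le_trans _ (BB k)) // lerDl addr_ge0.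
have Gm x : `|x| <= e -> `|G k m x| <= \sum_k Bk k.
  move=> xe; have [_ +] := bde x xe k => /le_trans; apply.
  by rewrite (le_trans _ (BB k)) // lerDr addr_ge0.
split; last exact: (taylor_bound (ltW e_gt0) (Gd m (leqnn m)) Gm te).
have := taylor_bound (ltW e_gt0) (Gd s sm) Gs te.
have -> // : (taylor_poly s (G k)).[t] = t ^+ k / k`!%:R.
rewrite horner_poly (bigD1 k) //= big1 => [|j jk].
  by rewrite /G wbasisn_wronskian eqxx addr0 mul1r mulrC.
by rewrite /G wbasisn_wronskian (negbTE jk) !mul0r.
Qed.

End BasisChange.

(** * The order of the method *)

Lemma near_right_itv (R : realType) (P : R -> Prop) (eps : R) : 0 < eps ->
  (forall h, 0 < h <= eps -> P h) -> \forall h \near (0 : R)^'+, P h.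
Proof.
move=> eps0 Ph; near=> h; apply: Ph; apply/andP; split; near: h.
  exact: nbhs_right_gt.
exact: nbhs_right_le.
Unshelve. all: end_near. Qed.

Lemma node_poly_orthogonal (R : realType) (s q : nat) (c : 'I_s -> R) :
  (forall j : nat, (j < q)%N ->
    \int[@lebesgue_measure R]_(x in `[0, 1])
      (x ^+ j * \prod_(i < s) (x - c i)) = 0) ->
  forall j, (j < q)%N -> moment j (node_poly c) 1 = 0.
Proof.
move=> orth j /orth <-; rewrite /moment -Rintegral_poly.
apply: eq_Rintegral => x _; rewrite hornerM hornerXn horner_prod.
by congr (_ * _); apply: eq_bigr => i _; rewrite hornerXsubC.
Qed.

(** Both error components reach the exponent s + q + 1.  That number is also the
    order of all the Taylor polynomials: the expansion of f takes it in each
    of its two variables, and that of w_k'' takes two more derivatives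
    of the basis. *)
Theorem frkn_order (R : realType) (s q : nat) (c : 'I_s -> R) (t0 T : R)
    (u : 'I_s -> R -> R) (f : R * R -> R) (tn : R) :
  injective c ->
  (forall k, class_C ((s + q).+1 + (s + q).+1).+2 (u k)) ->
  class_C ((s + q).+1 + (s + q).+1).+2 f ->
  lipschitz_snd f ->
  (forall j, (j < q)%N -> moment j (node_poly c) 1 = 0) ->
  t0 <= tn < t0 + T ->
  wronskian2_mx u tn \in unitmx ->
  frkn_order_at t0 T c u f tn (s + q).
Proof.
move=> c_inj uC fC [L' fL'] orth tnT Wu y dy sol.
set m := (s + q).+1 in uC fC *.
pose L := Num.max L' 0.
have L0 : 0 <= L by rewrite le_max lexx orbT.
have fL x y1 z1 : `|f (x, y1) - f (x, z1)| <= L * `|y1 - z1|.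
  by apply: le_trans (fL' x y1 z1) _; rewrite ler_wpM2r // le_max lexx.
set yn := y tn; set dn := dy tn.
have fCm : class_C (m + m) f by apply: class_C_le fC; exact: leqW (leqnSn _).
have [F [e1 e1P [C1 C10 fF]]] := bivariate_taylor tn yn fCm.
have [P [r [P0 dP0 PE]]] := picard_poly F yn dn m.
have [e2 /andP[e20 e21] [C2 C20 PC]] := residual_bound e1P C10 fF P0 PE.
have sm : (s <= m)%N by rewrite leqW ?leq_addr.
have mN : (m.+2 <= (m + m).+2)%N by rewrite !ltnS leq_addr.
have [e3 /andP[e30 e31] [B B0 [om omP]]] := wbasis_taylor Wu uC sm mN.
pose e := Num.min e2 e3.
have e01 : 0 < e <= 1 by rewrite lt_min e20 e30 /= ge_min e31 orbT.
have ee x : `|x| <= e -> [/\ `|x| <= e1, `|x| <= e2 & `|x| <= e3].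
  by rewrite le_min => /andP[x2 x3]; split => //; exact: le_trans e21.
have w_d k t : `|t| <= e -> is_derive t (1 : R) (wbasis u tn k) (wbasis1 u tn k t).
  by move=> _; exact: is_derive_wbasis uC _ _ _.
have dw_d k t : `|t| <= e -> is_derive t (1 : R) (wbasis1 u tn k) (wbasisn u tn 2 k t).
  by move=> _; exact: is_derive_wbasis1 uC _ _ _.
have w_s k t : `|t| <= e -> `|wbasisn u tn 2 k t - t ^+ k / k`!%:R| <= B * `|t| ^+ s.
  by case/ee => _ _ t3; have [] := omP k t t3.
have w_m k t : `|t| <= e -> `|wbasisn u tn 2 k t - (om k).[t]| <= B * `|t| ^+ m.
  by case/ee => _ _ t3; have [] := omP k t t3.
pose C := C1 + C2.
have C0 : 0 <= C by rewrite addr_ge0.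
have fFe a b : `|a| <= e -> `|b| <= e ->
    `|f (tn + a, yn + b) - F.[b%:P].[a]| <= C * (`|a| ^+ m + `|b| ^+ m).
  move=> /ee[a1 _ _] /ee[b1 _ _]; rewrite (le_trans (fF a b a1 b1)) //.
  by rewrite ler_wpM2r ?lerDl // addr_ge0 // exprn_ge0.
have PCe x : `|x| <= e -> `|P^`(2).[x] - f (tn + x, P.[x])| <= C * `|x| ^+ m.
  move=> /ee[_ x2 _]; rewrite (le_trans (PC x x2)) //.
  by rewrite ler_wpM2r ?lerDr // exprn_ge0.
have [eps4 /andP[eps40 _] ex_uniq] :=
  collocation_exists_unique c_inj tn yn dn L0 fL e01 B0 w_d dw_d
    (wbasis0 u tn) (wbasis10 u tn) w_s.
have [eps5 /andP[eps50 _] [C5 ord]] := collocation_order c_inj orth L0 fL e01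
  B0 w_d dw_d (wbasis0 u tn) (wbasis10 u tn) w_s w_m C0 fFe P0 dP0 PE PCe.
have [e6 e60 [C6 exact_bd]] := exact_solution_bound sol tnT L0 fL P0 dP0 e20 C20 PC.
have stepE h z : 0 < h <= eps4 -> frkn_step c u f tn yn dn h z <->
    exists be, [/\ collocates c f tn yn dn (wbasis u tn) (wbasisn u tn 2) h be,
      z.1 = coll_fun yn dn (wbasis u tn) be h &
      z.2 = coll_dfun dn (wbasis1 u tn) be h].
  move=> heps; have [Fu _ _] := ex_uniq h heps.
  by apply: frkn_stepE Wu _ _ _ _ _ _ Fu; case/andP: heps.
split.
  apply: (near_right_itv eps40) => h heps.
  have [_ [be cb] uniq] := ex_uniq h heps.
  exists (coll_fun yn dn (wbasis u tn) be h, coll_dfun dn (wbasis1 u tn) be h).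
  split; first by apply/stepE => //; exists be.
  move=> [z1 z2] /stepE -/(_ heps)[be' [cb' /= -> ->]].
  suff -> : be = be' by [].
  by apply/funext; exact: uniq.
exists (s + q)%N, (s + q)%N; split; first exact: minnn.
move=> y1 dy1 step1.
pose eps := Num.min eps4 (Num.min eps5 e6).
have eps0 : 0 < eps by rewrite !lt_min eps40 eps50 e60.
have bound : \forall h \near (0 : R)^'+,
    `|y (tn + h) - y1 h| <= (C6 + C5) * h ^+ m /\
    `|dy (tn + h) - dy1 h| <= (C6 + C5) * h ^+ m.
  have := near_right_itv eps0 (fun h hh => hh); apply: filterS2 step1 => h.
  move=> step_h /andP[h0]; rewrite !le_min => /and3P[h4 h5 h6].
  have h4' : 0 < h <= eps4 by rewrite h0.
  have h5' : 0 < h <= eps5 by rewrite h0.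
  have h6' : 0 <= h <= e6 by rewrite (ltW h0).
  have [+ _] := stepE h (y1 h, dy1 h) h4'.
  move=> /(_ step_h)[be [cb /= -> ->]].
  have [p1 p2] := ord h be h5' cb; have [x1 x2] := exact_bd h h6'.
  rewrite mulrDl; split.
    by rewrite -(subrK P.[h] (y (tn + h))) -addrA (le_trans (ler_normD _ _)) // lerD.
  by rewrite -(subrK P^`().[h] (dy (tn + h))) -addrA (le_trans (ler_normD _ _)) // lerD.
have bigO_bound (g : R -> R) :
    (\forall h \near (0 : R)^'+, `|g h| <= (C6 + C5) * h ^+ m) ->
    g =O_ ((0 : R)^'+) (fun h : R => h ^+ m).
  move=> gO; apply/eqO_exP; exists (`|C6 + C5| + 1); first by rewrite ltr_wpDl.
  near=> h.
  have gh : `|g h| <= (C6 + C5) * h ^+ m by near: h.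
  have h0 : 0 < h by near: h; exact: nbhs_right_gt.
  rewrite (le_trans gh) //= (ger0_norm (exprn_ge0 m (ltW h0))).
  by rewrite ler_wpM2r ?exprn_ge0 ?(ltW h0) // (le_trans (ler_norm _)) // lerDl.
by split; apply: bigO_bound; apply: filterS bound => h [].
Unshelve. all: end_near. Qed.

Theorem theorem4p7 (R : realType) (s q : nat) (hq : (1 <= q)%N) :
  exists N : nat,
  forall (c : 'I_s -> R) (t0 T : R) (u : 'I_s -> R -> R) (f : R * R -> R),
    injective c ->
    0 < T ->
    (forall k : 'I_s, class_C N (u k)) ->
    lin_indep u ->
    collocation_condition t0 T c u ->
    class_C N f ->
    lipschitz_snd f ->
    (forall j : nat, (j < q)%N ->
       \int[@lebesgue_measure R]_(x in `[0, 1])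
          (x ^+ j * \prod_(i < s) (x - c i)) = 0) ->
    forall tn : R, t0 <= tn < t0 + T ->
      wronskian2_mx u tn \in unitmx ->
      frkn_order_at t0 T c u f tn (s + q).
Proof.
exists ((s + q).+1 + (s + q).+1).+2.
move=> c t0 T u f c_inj _ uC _ _ fC fL orth tn tnT Wu.
exact: frkn_order c_inj uC fC fL (node_poly_orthogonal orth) tnT Wu.
Qed.
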